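(* There is an algorithm that, given an instance $(G,R,t,k)$ of Steiner Tree in which $G$ is an $n$-vertex unit disk graph (given as the intersection graph of $n$ unit disks in the plane), $R\subseteq V(G)$ is a set of $t$ terminals and $k$ is a positive integer, decides whether $(G,R,t,k)$ is a yes-instance in time $n^{O(\sqrt{t+k})}$.
   Context: Steiner Tree: the input $(G,R,t,k)$ consists of a graph $G$ on $n$ vertices (unweighted), a set $R\subseteq V(G)$ with $|R|=t$ whose elements are called terminals, and a positive integer $k$. The question is whether there is a tree $T$ that is a subgraph of $G$ with $R\subseteq V(T)$ and $|V(T)\setminus R|\le k$. Vertices of $V(T)\setminus R$ are called Steiner vertices. A unit disk graph is the intersection graph of finitely many unit disks in the plane: one vertex per disk, and two vertices are adjacent exactly when the corresponding disks intersect. *)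

(* Defs.v *)
From mathcomp Require Import all_boot all_order all_algebra.
From mathcomp Require Import all_classical all_reals.
From mathcomp Require Import exp.

Set Implicit Arguments.
Unset Strict Implicit.
Unset Printing Implicit Defensive.

Import Order.TTheory GRing.Theory Num.Theory.
Local Open Scope ring_scope.
Local Open Scope classical_set_scope.

(* -------------------------------------------------------------------------- *)
(* Unit disk graphs. Disks are closed and of radius 1; the family of centres  *)
(* need not be injective, so that equal disks are distinct, adjacent vertices.*)

Definition unit_disk (K : realType) (c : K * K) : set (K * K) :=
  [set p | (p.1 - c.1) ^+ 2 + (p.2 - c.2) ^+ 2 <= 1].

Definition disk_graph (K : realType) (n : nat) (c : 'I_n -> K * K) : rel 'I_n :=
  fun u v => (u != v) && `[< unit_disk (c u) `&` unit_disk (c v) !=set0 >].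

Lemma disk_graph_sym (K : realType) (n : nat) (c : 'I_n -> K * K) :
  symmetric (disk_graph c).
Proof. by move=> u v; rewrite /disk_graph eq_sym setIC. Qed.

Lemma disk_graph_irr (K : realType) (n : nat) (c : 'I_n -> K * K) :
  irreflexive (disk_graph c).
Proof. by move=> u; rewrite /disk_graph eqxx. Qed.

(* -------------------------------------------------------------------------- *)
(* Steiner Tree. A graph on V is a symmetric irreflexive relation; a subgraph *)
(* is given by its vertex set VT and its adjacency relation eT.               *)

Definition subgraph (V : finType) (e : rel V) (VT : {set V}) (eT : rel V) : Prop :=
  symmetric eT /\ forall u v, eT u v -> [&& u \in VT, v \in VT & e u v].

(* ucycle eT p: p lists without repetition the vertices of a closed walk of   *)
(* eT. In a simple graph it is a cycle exactly when it has at least three of  *)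
(* them; a single edge gives such a p with size 2.                            *)
Definition acyclic (V : finType) (eT : rel V) : Prop :=
  forall p : seq V, ucycle eT p -> (size p <= 2)%N.

Definition is_tree (V : finType) (VT : {set V}) (eT : rel V) : Prop :=
  [/\ VT != finset.set0, {in VT &, forall u v, connect eT u v} & acyclic eT].

Definition steiner_yes (V : finType) (e : rel V) (R : {set V}) (k : nat) : Prop :=
  exists (VT : {set V}) (eT : rel V),
    [/\ subgraph e VT eT, is_tree VT eT, R \subset VT & (#|VT :\: R| <= k)%N].

(* -------------------------------------------------------------------------- *)
(* Model of computation: a real RAM with structured control flow.             *)
(*                                                                            *)
(* The memory consists of nat-indexed arrays of unbounded length, holding     *)
(* natural numbers or exact real numbers; a fixed program can only name       *)
(* finitely many of the arrays, and cell 0 of an array serves as a scalar     *)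
(* variable. Array indices are computed at run time (indirect addressing).    *)
(*                                                                            *)
(* Every assignment and every evaluation of a test takes one unit of time.    *)
(* Expressions are part of the program text, hence of bounded size, so that   *)
(* charging for each of their operations would only change the time by a      *)
(* constant factor.                                                           *)
(*                                                                            *)
(* The instruction set is restricted so that unit costs are not abusive.      *)
(* Natural numbers only have addition and (truncated) subtraction: in T steps *)
(* their binary length grows by O(T) at most. Real numbers have ring          *)
(* operations and comparison, but no rounding to integers, and the only       *)
(* constants that a program can mention are natural numbers.                  *)

Inductive nexp : Type :=
| NCst of nat
| NCell of nat & nexp
| NAdd of nexp & nexp
| NSub of nexp & nexp.

Inductive rexp : Type :=
| RCst of nat
| RCell of nat & nexp
| RAdd of rexp & rexp
| RSub of rexp & rexp
| RMul of rexp & rexp.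

Inductive test : Type :=
| NLe of nexp & nexp
| RLe of rexp & rexp.

Inductive prog : Type :=
| Skip
| NSet of nat & nexp & nexp
| RSet of nat & nexp & rexp
| Seq of prog & prog
| If of test & prog & prog
| While of test & prog.

Record state (K : realType) : Type := State {
  nmem : nat -> nat -> nat;
  rmem : nat -> nat -> K
}.

Definition upd (A : Type) (m : nat -> nat -> A) (a i : nat) (x : A) :
    nat -> nat -> A :=
  fun b j => if (b == a) && (j == i) then x else m b j.

Fixpoint neval (K : realType) (s : state K) (e : nexp) : nat :=
  match e with
  | NCst x => x
  | NCell a i => nmem s a (neval s i)
  | NAdd e1 e2 => (neval s e1 + neval s e2)%N
  | NSub e1 e2 => (neval s e1 - neval s e2)%N
  end.

Fixpoint reval (K : realType) (s : state K) (e : rexp) : K :=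
  match e with
  | RCst x => x%:R
  | RCell a i => rmem s a (neval s i)
  | RAdd e1 e2 => reval s e1 + reval s e2
  | RSub e1 e2 => reval s e1 - reval s e2
  | RMul e1 e2 => reval s e1 * reval s e2
  end.

Definition teval (K : realType) (s : state K) (b : test) : bool :=
  match b with
  | NLe e1 e2 => (neval s e1 <= neval s e2)%N
  | RLe e1 e2 => reval s e1 <= reval s e2
  end.

(* exec p s m s': p, started in s, terminates in s' after m units of time.    *)
Inductive exec (K : realType) : prog -> state K -> nat -> state K -> Prop :=
| exec_skip s : exec Skip s 0 s
| exec_nset s a i e :
    exec (NSet a i e) s 1
      (State (upd (nmem s) a (neval s i) (neval s e)) (rmem s))
| exec_rset s a i e :
    exec (RSet a i e) s 1
      (State (nmem s) (upd (rmem s) a (neval s i) (reval s e)))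
| exec_seq p q s1 s2 s3 m1 m2 :
    exec p s1 m1 s2 -> exec q s2 m2 s3 -> exec (Seq p q) s1 (m1 + m2) s3
| exec_if b p q s s' m :
    exec (if teval s b then p else q) s m s' -> exec (If b p q) s m.+1 s'
| exec_while_end b p s :
    ~~ teval s b -> exec (While b p) s 1 s
| exec_while_loop b p s1 s2 s3 m1 m2 :
    teval s1 b -> exec p s1 m1 s2 -> exec (While b p) s2 m2 s3 ->
    exec (While b p) s1 (m1 + m2).+1 s3.

(* By determinism, the existence of an execution with given properties says   *)
(* that the run of the program terminates and has them.                       *)
Lemma exec_det (K : realType) (p : prog) (s s1 s2 : state K) (m1 m2 : nat) :
  exec p s m1 s1 -> exec p s m2 s2 -> m1 = m2 /\ s1 = s2.
Proof.
move=> h; elim: h m2 s2 => {p s m1 s1}.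
- by move=> s m s2 h; inversion h.
- by move=> s a i e m s2 h; inversion h.
- by move=> s a i e m s2 h; inversion h.
- move=> p q s1 s2 s3 m1 m2 _ IH1 _ IH2 m s h.
  inversion h as [| | |? ? ? s2' ? ? ? h1 h2| | |]; subst.
  by have [-> es] := IH1 _ _ h1; subst; have [-> ->] := IH2 _ _ h2.
- move=> b p q s s' m _ IH m2 s2 h.
  inversion h as [| | | |? ? ? ? ? ? h1| |]; subst.
  by have [-> ->] := IH _ _ h1.
- move=> b p s /negP nb m s2 h.
  by inversion h as [| | | | | |? ? ? ? ? ? ? tb]; subst.
- move=> b p s1 s2 s3 m1 m2 tb _ IH1 _ IH2 m s h.
  inversion h as [| | | | |? ? ? nb|? ? ? ? ? ? ? tb' h1 h2]; subst.
    by rewrite tb in nb.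
  by have [-> es] := IH1 _ _ h1; subst; have [-> ->] := IH2 _ _ h2.
Qed.

(* Integer array 0 holds n, t, k; integer array 1 holds the indicator         *)
(* function of R; real arrays 0 and 1 hold the coordinates of the centres.    *)
(* All other cells are 0.                                                     *)
Definition input (K : realType) (n : nat) (c : 'I_n -> K * K) (R : {set 'I_n})
    (t k : nat) : state K :=
  State
    (fun a i => if a == 0%N then nth 0%N [:: n; t; k] i
                else if a == 1%N then
                  (if insub i is Some v then nat_of_bool (v \in R) else 0%N)
                else 0%N)
    (fun a i => if insub i is Some v then
                  (if a == 0%N then (c v).1
                   else if a == 1%N then (c v).2 else 0)
                else 0).

Definition accepts (K : realType) (s : state K) : bool := nmem s 0 0 == 1%N.

(* Main.v *)
(* Cut the plane into unit cells, so that the vertices in a cell form a clique.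
   A solution X is then connected by a sparse subgraph: a star in each cell and
   one edge for each pair of cells that X links. Let w be sqrt (t + k), rounded
   up, and group the columns of cells into strips of 2w columns. On average over
   w shifts, the first two columns of the strips hold at most w vertices of X.
   For such a shift, scan the vertices strip by strip, upwards in each strip: at
   any time only O(w) scanned vertices of X have a sparse edge to an unscanned
   one, because such an edge either crosses the current height in the current
   strip or enters the first two columns of a strip.

   That X is connected is certified locally by distances to a terminal rho: each
   other vertex of X at distance d needs a neighbour in X at distance d - 1. The
   scan only has to remember O(w) distances that unscanned vertices rely on,
   O(w) demands to be met by unscanned vertices, and the number of Steiner
   vertices. This makes n ^ O(w) states; the program computes, for each shift,
   which of them are reachable, testing all pairs of states at each vertex. *)
Require Import Defs.
From mathcomp Require Import all_boot all_order all_algebra.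
From mathcomp Require Import all_classical all_reals.
From mathcomp Require Import exp.
From mathcomp Require Import zify ring lra.
Set Implicit Arguments.
Unset Strict Implicit.
Unset Printing Implicit Defensive.
Import Order.TTheory GRing.Theory Num.Theory.
Local Open Scope ring_scope.


(** * Programs with bounded loops *)

Section Loops.
Local Open Scope nat_scope.
Variable K : realType.
Implicit Types s : state K.

(** Only completeness involves geometry. Any run of the scan certifies a solution, whatever the
    shift and the order, so the program needs to know neither the cells, nor the sparse subgraph,
    nor which shift is good: it tries all of them on all codes, whether or not these come from a
    solution. Distances replace the usual partition of the front into connected components. Each
    vertex only has to point to one neighbour, and the drop of the distance excludes circular
    support, so a step becomes a test with bounded quantifiers on two states. Since that neighbour
    may come earlier or later in the scan, both facts to rely on and demands are remembered. The
    width balances two costs: the current height meets O(w) cells of its strip, while the boundary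
    columns hold about |X| / w vertices; both are O(w) because |X| is at most w * w. The machine
    cannot round reals or multiply naturals: strip indices are obtained by counting boundaries, and
    digits from tables. All loop bounds are at most the number S of codes and loops are nested to a
    fixed depth, so the time is polynomial in S. *)

Definition setn s a i x : state K := State (upd (nmem s) a i x) (rmem s).
Definition setr s a i x : state K := State (nmem s) (upd (rmem s) a i x).

(** With counted loops only, every command terminates: its meaning is a function [den], and its time
    is bounded by a number [cost] read off the text. *)
Inductive cmd : Type :=
| CSkip
| CN of nat & nexp & nexp
| CR of nat & nexp & rexp
| CSeq of cmd & cmd
| CIf of test & cmd & cmd
(* [CFor x b c] runs c for x = 0, 1, ... below the value of b. *)
| CFor of nat & nat & cmd.

Definition ncell a := NCell a (NCst 0).

Fixpoint comp (c : cmd) : prog :=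
  match c with
  | CSkip => Skip
  | CN a i e => NSet a i e
  | CR a i e => RSet a i e
  | CSeq c1 c2 => Seq (comp c1) (comp c2)
  | CIf b c1 c2 => If b (comp c1) (comp c2)
  | CFor x b c => Seq (NSet x (NCst 0) (NCst 0))
      (While (NLe (NAdd (ncell x) (NCst 1)) (ncell b))
        (Seq (comp c) (NSet x (NCst 0) (NAdd (ncell x) (NCst 1)))))
  end.

Definition incr x s : state K := setn s x 0 (nmem s x 0 + 1).

Fixpoint den (c : cmd) (s : state K) : state K :=
  match c with
  | CSkip => s
  | CN a i e => setn s a (neval s i) (neval s e)
  | CR a i e => setr s a (neval s i) (reval s e)
  | CSeq c1 c2 => den c2 (den c1 s)
  | CIf b c1 c2 => if teval s b then den c1 s else den c2 s
  | CFor x b c => iter (nmem s b 0) (fun s' => incr x (den c s')) (setn s x 0 0)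
  end.

Fixpoint nmods (c : cmd) : seq nat :=
  match c with
  | CSkip => [::]
  | CN a _ _ => [:: a]
  | CR _ _ _ => [::]
  | CSeq c1 c2 => nmods c1 ++ nmods c2
  | CIf _ c1 c2 => nmods c1 ++ nmods c2
  | CFor x _ c => x :: nmods c
  end.

Fixpoint rmods (c : cmd) : seq nat :=
  match c with
  | CSkip => [::]
  | CN _ _ _ => [::]
  | CR a _ _ => [:: a]
  | CSeq c1 c2 => rmods c1 ++ rmods c2
  | CIf _ c1 c2 => rmods c1 ++ rmods c2
  | CFor _ _ c => rmods c
  end.

(* The loop bounds are among bs and never change, so that [cost] below applies
   with any D above their initial values. *)
Fixpoint bounded_by (bs : seq nat) (c : cmd) : bool :=
  match c with
  | CSkip => true
  | CN a _ _ => a \notin bs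
  | CR _ _ _ => true
  | CSeq c1 c2 => bounded_by bs c1 && bounded_by bs c2
  | CIf _ c1 c2 => bounded_by bs c1 && bounded_by bs c2
  | CFor x b c => [&& b \in bs, x \notin bs, x \notin nmods c & bounded_by bs c]
  end.

Fixpoint cost (D : nat) (c : cmd) : nat :=
  match c with
  | CSkip => 0
  | CN _ _ _ | CR _ _ _ => 1
  | CSeq c1 c2 => cost D c1 + cost D c2
  | CIf _ c1 c2 => (cost D c1 + cost D c2).+1
  | CFor _ _ c => (D * (cost D c + 2)).+2
  end.

Lemma upd_neq A (m : nat -> nat -> A) a i x b : b != a -> upd m a i x b = m b.
Proof. by move=> /negbTE h; rewrite /upd h. Qed.

Lemma upd_eq A (m : nat -> nat -> A) a i x : upd m a i x a i = x.
Proof. by rewrite /upd !eqxx. Qed.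

Lemma nmem_den c s a : a \notin nmods c -> nmem (den c s) a = nmem s a.
Proof.
elim: c s => [|b i e|b i e|c1 IH1 c2 IH2|b c1 IH1 c2 IH2|x b c IH] s //=.
- by rewrite inE => h; rewrite upd_neq.
- by rewrite mem_cat negb_or => /andP[h1 h2]; rewrite IH2 // IH1.
- by rewrite mem_cat negb_or => /andP[h1 h2]; case: ifP => _; rewrite ?IH1 ?IH2.
- rewrite inE negb_or => /andP[ax ac].
  elim: (nmem s b 0) => [|k IHk] /=; first by rewrite upd_neq.
  by rewrite upd_neq // IH.
Qed.

Lemma rmem_den c s a : a \notin rmods c -> rmem (den c s) a = rmem s a.
Proof.
elim: c s => [|b i e|b i e|c1 IH1 c2 IH2|b c1 IH1 c2 IH2|x b c IH] s //=.
- by rewrite inE => h; rewrite upd_neq.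
- by rewrite mem_cat negb_or => /andP[h1 h2]; rewrite IH2 // IH1.
- by rewrite mem_cat negb_or => /andP[h1 h2]; case: ifP => _; rewrite ?IH1 ?IH2.
- by move=> ac; elim: (nmem s b 0) => [|k IHk] //=; rewrite IH.
Qed.

Lemma bounded_by_mods bs c b : bounded_by bs c -> b \in bs -> b \notin nmods c.
Proof.
move=> + bb; elim: c => [|a i e|a i e|c1 IH1 c2 IH2|t c1 IH1 c2 IH2|x a c IH] //=.
- by move=> h; rewrite inE; apply: contraNneq h => <-.
- by case/andP=> /IH1 h1 /IH2 h2; rewrite mem_cat negb_or h1.
- by case/andP=> /IH1 h1 /IH2 h2; rewrite mem_cat negb_or h1.
- case/and4P=> _ xb _ /IH h; rewrite inE negb_or h andbT.
  by apply: contraNneq xb => <-.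
Qed.

Lemma exec_comp bs D c s :
    bounded_by bs c -> (forall b, b \in bs -> nmem s b 0 <= D) ->
  exists m, exec (comp c) s m (den c s) /\ m <= cost D c.
Proof.
elim: c s => [|a i e|a i e|c1 IH1 c2 IH2|t c1 IH1 c2 IH2|x a c IH] s /=.
- by exists 0; split=> //; constructor.
- by exists 1; split=> //; constructor.
- by exists 1; split=> //; constructor.
- case/andP=> h1 h2 hs.
  have [m1 [e1 l1]] := IH1 s h1 hs.
  have [|m2 [e2 l2]] := IH2 (den c1 s) h2.
    by move=> b bb; rewrite nmem_den ?hs // (bounded_by_mods h1 bb).
  by exists (m1 + m2); split; [exact: exec_seq e1 e2|exact: leq_add].
- case/andP=> h1 h2 hs; case E: (teval s t).
    have [m [e l]] := IH1 s h1 hs.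
    by exists m.+1; split; [constructor; rewrite E|lia].
  have [m [e l]] := IH2 s h2 hs.
  by exists m.+1; split; [constructor; rewrite E|lia].
- case/and4P=> ab xb xc hc hs.
  set w := While _ _; set f := fun s' => incr x (den c s'); set s0 := setn s x 0 0.
  have ax : a != x by apply: contraNneq xb => <-.
  have ac := bounded_by_mods hc ab.
  have main j s' : nmem s' x 0 + j = nmem s a 0 ->
      (forall b, b \in bs -> nmem s' b = nmem s b) ->
      exists m, exec w s' m (iter j f s') /\ m <= (j * (cost D c + 2)).+1.
    elim: j s' => [|j IHj] s' hx hb.
      exists 1; split=> //; apply: exec_while_end.
      by rewrite /= (hb a) // -hx; lia.
    have [|m1 [e1 l1]] := IH s' hc; first by move=> b bb; rewrite hb // hs.
    have [||m2 [e2 l2]] := IHj (f s').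
    + by rewrite -hx /f /incr /= upd_eq nmem_den // -addnA add1n.
    + move=> b bb; rewrite /f /incr /= upd_neq ?nmem_den ?hb //.
        exact: bounded_by_mods bb.
      by apply: contraNneq xb => <-.
    exists (m1 + 1 + m2).+1; split; last by lia.
    rewrite iterSr; apply: exec_while_loop e2.
      by rewrite /= (hb a) //; lia.
    by apply: exec_seq e1 _; constructor.
  have [||m [e l]] := main (nmem s a 0) s0.
  + by rewrite /= upd_eq.
  + move=> b bb; rewrite /= upd_neq //.
    by apply: contraNneq xb => <-.
  exists (1 + m); split; first by apply: exec_seq e; constructor.
  have : nmem s a 0 * (cost D c + 2) <= D * (cost D c + 2).
    by rewrite leq_mul2r hs // orbT.
  by lia.
Qed.

(** Each loop multiplies the bound by about [D], so the text of the command alone fixes the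
    degree. *)
Lemma cost_poly c : exists k, forall D, cost D c <= k * D.+1 ^ k.
Proof.
elim: c => [|a i e|a i e|c1 [k1 h1] c2 [k2 h2]|t c1 [k1 h1] c2 [k2 h2]|x a c [k h]] /=.
- by exists 0.
- by exists 1 => D; rewrite expn1.
- by exists 1 => D; rewrite expn1.
- exists (k1 + k2) => D; apply: leq_trans (leq_add (h1 D) (h2 D)) _.
  by rewrite mulnDl leq_add // leq_mul // leq_pexp2l //; lia.
- exists (k1 + k2).+1 => D.
  rewrite mulSn -add1n leq_add ?expn_gt0 //.
  apply: leq_trans (leq_add (h1 D) (h2 D)) _.
  by rewrite mulnDl leq_add // leq_mul // leq_pexp2l //; lia.
- exists (k + 4) => D.
  have e1 : 1 <= D.+1 ^ k by rewrite expn_gt0.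
  have : D.+1 ^ k.+1 <= D.+1 ^ (k + 4) by rewrite leq_pexp2l //; lia.
  move: (h D) e1; rewrite expnS; set p := D.+1 ^ k; set q := D.+1 ^ (k + 4).
  move=> hc p1 pq; apply: (@leq_trans ((k + 4) * (D.+1 * p))); last first.
    by rewrite leq_mul2l pq orbT.
  by nia.
Qed.

(** The step may use the value of the counter and the contents of all arrays that the loop does not
    assign, so that an invariant only has to mention what changes. *)
Lemma for_ind (Inv : nat -> state K -> Prop) x b c s :
    x \notin nmods c -> x != b -> b \notin nmods c ->
    Inv 0 (setn s x 0 0) ->
    (forall i s', i < nmem s b 0 -> nmem s' x 0 = i ->
       (forall a, a \notin nmods (CFor x b c) -> nmem s' a = nmem s a) ->
       (forall a, a \notin rmods c -> rmem s' a = rmem s a) ->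
       Inv i s' -> Inv i.+1 (incr x (den c s'))) ->
  Inv (nmem s b 0) (den (CFor x b c) s).
Proof.
move=> xc xb bc h0 hS /=.
set f := fun s' => incr x (den c s').
suff : forall j, j <= nmem s b 0 -> let s' := iter j f (setn s x 0 0) in
    [/\ nmem s' x 0 = j,
     forall a, a \notin nmods (CFor x b c) -> nmem s' a = nmem s a,
     forall a, a \notin rmods c -> rmem s' a = rmem s a & Inv j s'].
  by case/(_ _ (leqnn _)).
elim=> [|j IHj] hj /=.
  split=> //; first by rewrite upd_eq.
  by move=> a; rewrite inE negb_or => /andP[ax _]; rewrite upd_neq.
have [hx hn hr hI] := IHj (ltnW hj); split.
- by rewrite upd_eq nmem_den // hx addn1.
- move=> a ha; have := ha; rewrite inE negb_or => /andP[ax ac].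
  by rewrite upd_neq // nmem_den // hn.
- by move=> a ha; rewrite rmem_den // hr.
- exact: hS.
Qed.

(** * Tests with bounded quantifiers and their compilation *)

Inductive fml : Type :=
| FA of test
| FNot of fml
| FAnd of fml & fml
| FOr of fml & fml
| FEx of nat & nat & fml
| FAll of nat & nat & fml.

Fixpoint fev s (f : fml) : bool :=
  match f with
  | FA b => teval s b
  | FNot f => ~~ fev s f
  | FAnd f g => fev s f && fev s g
  | FOr f g => fev s f || fev s g
  | FEx x b f => has (fun i => fev (setn s x 0 i) f) (iota 0 (nmem s b 0))
  | FAll x b f => all (fun i => fev (setn s x 0 i) f) (iota 0 (nmem s b 0))
  end.

(* The truth value is left in cell 0 of array r. *)
Fixpoint chk (r : nat) (f : fml) : cmd :=
  let tt := NLe (NCst 1) (ncell r) in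
  let set x := CN r (NCst 0) (NCst x) in
  match f with
  | FA b => CIf b (set 1) (set 0)
  | FNot f => CSeq (chk r f) (CN r (NCst 0) (NSub (NCst 1) (ncell r)))
  | FAnd f g => CSeq (chk r f) (CIf tt (chk r g) CSkip)
  | FOr f g => CSeq (chk r f) (CIf tt CSkip (chk r g))
  | FEx x b f => CSeq (set 0) (CFor x b (CIf tt CSkip (chk r f)))
  | FAll x b f => CSeq (set 1) (CFor x b (CIf tt (chk r f) CSkip))
  end.

Fixpoint nreads (e : nexp) : seq nat :=
  match e with
  | NCst _ => [::]
  | NCell a i => a :: nreads i
  | NAdd e1 e2 | NSub e1 e2 => nreads e1 ++ nreads e2
  end.

Fixpoint rreads (e : rexp) : seq nat :=
  match e with
  | RCst _ => [::]
  | RCell _ i => nreads i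
  | RAdd e1 e2 | RSub e1 e2 | RMul e1 e2 => rreads e1 ++ rreads e2
  end.

Definition treads (t : test) : seq nat :=
  match t with
  | NLe e1 e2 => nreads e1 ++ nreads e2
  | RLe e1 e2 => rreads e1 ++ rreads e2
  end.

Fixpoint fv (f : fml) : seq nat :=
  match f with
  | FA b => treads b
  | FNot f => fv f
  | FAnd f g | FOr f g => fv f ++ fv g
  | FEx x b f | FAll x b f => b :: [seq a <- fv f | a != x]
  end.

Fixpoint bv (f : fml) : seq nat :=
  match f with
  | FA b => [::]
  | FNot f => bv f
  | FAnd f g | FOr f g => bv f ++ bv g
  | FEx x b f | FAll x b f => x :: bv f
  end.

(** Bound variables and the result live in memory cells that evaluation overwrites. A part that is
    evaluated later, or again in the next round of a loop, must not read them. *)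
Fixpoint wff (r : nat) (f : fml) : bool :=
  match f with
  | FA b => r \notin treads b
  | FNot f => wff r f
  | FAnd f g | FOr f g => [&& wff r f, wff r g & all (fun a => a \notin r :: bv f) (fv g)]
  | FEx x b f | FAll x b f =>
    [&& wff r f, x != r, x \notin bv f, b \notin r :: x :: bv f & all (fun a => a \notin r :: bv f) (fv f)]
  end.

(* Only the cells 0 of arrays outside W may differ. *)
Definition agree (W : seq nat) s s' : Prop :=
  [/\ rmem s = rmem s', forall a, a \in W -> nmem s a 0 = nmem s' a 0
    & forall a j, nmem s a j.+1 = nmem s' a j.+1].

Lemma agree_cat W1 W2 s s' : agree (W1 ++ W2) s s' -> agree W1 s s' /\ agree W2 s s'.
Proof.
by case=> hr h h'; split; split=> // a ha; apply: h; rewrite mem_cat ha ?orbT.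
Qed.

Lemma neval_agree e s s' : agree (nreads e) s s' -> neval s e = neval s' e.
Proof.
elim: e => [//|a e IH|e1 IH1 e2 IH2|e1 IH1 e2 IH2] /=.
- case=> hr h h'; rewrite IH.
    by case: (neval s' e) => [|j]; rewrite ?h' // h ?mem_head.
  by split=> // b hb; apply: h; rewrite inE hb orbT.
- by move/agree_cat => [/IH1 -> /IH2 ->].
- by move/agree_cat => [/IH1 -> /IH2 ->].
Qed.

Lemma reval_agree e s s' : agree (rreads e) s s' -> reval s e = reval s' e.
Proof.
elim: e => [//|a e|e1 IH1 e2 IH2|e1 IH1 e2 IH2|e1 IH1 e2 IH2] /=.
- by move=> h; rewrite (neval_agree h); case: h => ->.
- by move/agree_cat => [/IH1 -> /IH2 ->].
- by move/agree_cat => [/IH1 -> /IH2 ->].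
- by move/agree_cat => [/IH1 -> /IH2 ->].
Qed.

Lemma teval_agree t s s' : agree (treads t) s s' -> teval s t = teval s' t.
Proof.
case: t => e1 e2 /= /agree_cat[h1 h2].
  by rewrite (neval_agree h1) (neval_agree h2).
by rewrite (reval_agree h1) (reval_agree h2).
Qed.

Lemma agree_bind x b W s s' i : agree (b :: [seq a <- W | a != x]) s s' ->
  agree W (setn s x 0 i) (setn s' x 0 i).
Proof.
case=> hr h h'; split=> //= a.
  move=> ha; have [->|ax] := eqVneq a x; first by rewrite !upd_eq.
  by rewrite !upd_neq // h // inE mem_filter ax ha orbT.
by move=> j; rewrite /upd /= !andbF.
Qed.

Lemma fev_agree f s s' : agree (fv f) s s' -> fev s f = fev s' f.
Proof.
elim: f s s' => [t|f IH|f IHf g IHg|f IHf g IHg|x b f IH|x b f IH] s s' /=.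
- exact: teval_agree.
- by move=> /IH ->.
- by case/agree_cat => /IHf -> /IHg ->.
- by case/agree_cat => /IHf -> /IHg ->.
- move=> h; have -> : nmem s b 0 = nmem s' b 0 by case: h => _ ->; rewrite ?mem_head.
  by apply: eq_has => i; apply: IH; apply: agree_bind h.
- move=> h; have -> : nmem s b 0 = nmem s' b 0 by case: h => _ ->; rewrite ?mem_head.
  by apply: eq_all => i; apply: IH; apply: agree_bind h.
Qed.

Lemma nmods_chk r f : {subset nmods (chk r f) <= r :: bv f}.
Proof.
elim: f => [t|f IH|f IHf g IHg|f IHf g IHg|x b f IH|x b f IH] a /=.
- by rewrite !inE => /orP[] ->.
- by rewrite mem_cat mem_seq1 => /orP[/IH //|/eqP->]; rewrite mem_head.
- by rewrite !inE !mem_cat orbF; case/orP=> [/IHf|/IHg];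
    rewrite inE => /orP[] ->; rewrite ?orbT.
- by rewrite !inE !mem_cat; case/orP=> [/IHf|/IHg];
    rewrite inE => /orP[] ->; rewrite ?orbT.
- by rewrite !inE => /or3P[-> //|->|/IH]; rewrite ?orbT // inE;
    case/orP => ->; rewrite ?orbT.
- by rewrite !inE cats0 => /or3P[-> //|->|/IH]; rewrite ?orbT // inE;
    case/orP => ->; rewrite ?orbT.
Qed.

Lemma rmods_chk r f : rmods (chk r f) = [::].
Proof.
by elim: f => [t|f IH|f IHf g IHg|f IHf g IHg|x b f IH|x b f IH] //=;
  rewrite ?IH ?IHf ?IHg.
Qed.

Lemma rmem_den_chk r f s : rmem (den (chk r f) s) = rmem s.
Proof. by apply: funext => a; rewrite rmem_den // rmods_chk. Qed.

Lemma den_chkS r f s a j : nmem (den (chk r f) s) a j.+1 = nmem s a j.+1.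
Proof.
elim: f s => [t|f IH|f IHf g IHg|f IHf g IHg|x b f IH|x b f IH] s //=.
- by case: ifP => _ /=; rewrite /upd andbF.
- by rewrite /upd andbF IH.
- by case: ifP => _ /=; rewrite ?IHg IHf.
- by case: ifP => _ /=; rewrite ?IHg IHf.
- elim: (upd _ _ _ _ _ _) => [|k IHk]; first by rewrite /= /upd !andbF.
  by rewrite iterS /incr /= {1}/upd andbF; case: ifP => _; rewrite ?IH IHk.
- elim: (upd _ _ _ _ _ _) => [|k IHk]; first by rewrite /= /upd !andbF.
  by rewrite iterS /incr /= {1}/upd andbF; case: ifP => _; rewrite ?IH IHk.
Qed.

Lemma agree_chk r f W s : all (fun a => a \notin r :: bv f) W ->
  agree W (den (chk r f) s) s.
Proof.
move=> /allP h; split; first exact: rmem_den_chk.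
  move=> a /h ha; rewrite nmem_den //; apply: contra ha; exact: nmods_chk.
by move=> a j; rewrite den_chkS.
Qed.

Lemma den_chk r f s : wff r f -> nmem (den (chk r f) s) r 0 = fev s f :> nat.
Proof.
elim: f s => [t|f IH|f IHf g IHg|f IHf g IHg|x b f IH|x b f IH] s /=.
- by case: ifP => _ _ /=; rewrite upd_eq.
- by move=> /IH h; rewrite upd_eq h; case: fev.
- case/and3P => hf hg hd; rewrite IHf //; case E: (fev s f) => /=; last by rewrite IHf // E.
  by rewrite IHg // (fev_agree (agree_chk _ hd)).
- case/and3P => hf hg hd; rewrite IHf //; case E: (fev s f) => /=; first by rewrite IHf // E.
  by rewrite IHg // (fev_agree (agree_chk _ hd)).
- move=> /and5P[hf xr xf hb hd].
  have xm : x \notin nmods (chk r f).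
    by apply: contra xf => /nmods_chk; rewrite inE (negbTE xr).
  move: hb; rewrite !inE !negb_or => /and3P[br bx bf].
  set s0 := setn s r 0 0.
  pose Inv i s' := nmem s' r 0 = has (fun i => fev (setn s x 0 i) f) (iota 0 i) :> nat
    /\ forall a j, nmem s' a j.+1 = nmem s a j.+1.
  have -> : nmem s b 0 = nmem s0 b 0 by rewrite /= upd_neq.
  suff [] : Inv (nmem s0 b 0) (den (CFor x b (CIf (NLe (NCst 1) (ncell r)) CSkip (chk r f))) s0) by [].
  apply: for_ind => //; first by rewrite eq_sym.
  + by apply: contra bf => /nmods_chk; rewrite inE (negbTE br).
  + split; first by rewrite /= upd_neq 1?eq_sym // upd_eq.
    by move=> a j; rewrite /= /upd !andbF.
  move=> i s' ib hx hfr hrm [hI hI'].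
  (* The state in the loop differs from [setn s x 0 i] only in cells overwritten by earlier rounds,
     none of which [f] reads. *)
  have ag : agree (fv f) s' (setn s x 0 i).
    split=> [|a ha|a j]; last by rewrite hI' /= /upd andbF.
      by apply: funext => a; rewrite hrm //= rmods_chk.
    rewrite /=; have [->|ax] := eqVneq a x; first by rewrite upd_eq.
    have := allP hd _ ha; rewrite inE negb_or => /andP[ar abv].
    rewrite upd_neq // hfr /= ?upd_neq // inE negb_or ax /=.
    by apply: contra abv => /nmods_chk; rewrite inE (negbTE ar).
  split; last first.
    move=> a j; rewrite /= /upd andbF.
    by case: ifP => _; rewrite ?den_chkS.
  rewrite -[i.+1]addn1 iotaD has_cat /= upd_neq 1?eq_sym // orbF add0n hI.
  case E: has => /=; first by rewrite hI E.
  by rewrite IH // (fev_agree ag).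
- move=> /and5P[hf xr xf hb hd].
  have xm : x \notin nmods (chk r f).
    by apply: contra xf => /nmods_chk; rewrite inE (negbTE xr).
  move: hb; rewrite !inE !negb_or => /and3P[br bx bf].
  set s0 := setn s r 0 1.
  pose Inv i s' := nmem s' r 0 = all (fun i => fev (setn s x 0 i) f) (iota 0 i) :> nat
    /\ forall a j, nmem s' a j.+1 = nmem s a j.+1.
  have -> : nmem s b 0 = nmem s0 b 0 by rewrite /= upd_neq.
  suff [] : Inv (nmem s0 b 0) (den (CFor x b (CIf (NLe (NCst 1) (ncell r)) (chk r f) CSkip)) s0) by [].
  apply: for_ind => //; rewrite /= ?cats0 //; first by rewrite eq_sym.
  + by apply: contra bf => /nmods_chk; rewrite inE (negbTE br).
  + split; first by rewrite /= upd_neq 1?eq_sym // upd_eq.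
    by move=> a j; rewrite /= /upd !andbF.
  move=> i s' ib hx hfr hrm [hI hI'].
  have ag : agree (fv f) s' (setn s x 0 i).
    split=> [|a ha|a j]; last by rewrite hI' /= /upd andbF.
      by apply: funext => a; rewrite hrm // rmods_chk.
    rewrite /=; have [->|ax] := eqVneq a x; first by rewrite upd_eq.
    have := allP hd _ ha; rewrite inE negb_or => /andP[ar abv].
    rewrite upd_neq // hfr /= ?upd_neq // inE negb_or ax /=.
    by apply: contra abv => /nmods_chk; rewrite inE (negbTE ar).
  split; last first.
    move=> a j; rewrite /= /upd andbF.
    by case: ifP => _; rewrite ?den_chkS.
  rewrite -[i.+1]addn1 iotaD all_cat /= upd_neq 1?eq_sym // andbT add0n hI.
  case E: all => /=; last by rewrite hI E.
  by rewrite IH // (fev_agree ag).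
Qed.
End Loops.

(** * Scanning states and certificates of connectivity *)

Section Scan.
Local Open Scope nat_scope.
Variables (V : finType) (adj : rel V) (R : {set V}).

(* A fact (v, d) says that v is in the solution, at distance d from the root. In
   a state, P lists facts that unscanned vertices may rely on, Q the scanned
   facts whose neighbour at distance d - 1 is still to come, and m counts the
   Steiner vertices. The fact (rho, 0) pads both lists: it holds in advance as
   rho is a terminal, and as a demand it need not be met. *)
Definition fact : Type := (V * nat)%type.

(** Inclusions suffice: forgetting a fact or adding a demand only makes the rest of a run harder.
    They also make the order and repetitions of the coded lists irrelevant. *)
Definition skips (v : V) (P Q : fact -> Prop) (m : nat) (P' Q' : fact -> Prop) (m' : nat) : Prop :=
  [/\ v \notin R, forall f, P' f -> P f, forall f, Q f -> Q' f & m' = m].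

Definition takes (v : V) (d : nat) (P Q : fact -> Prop) (m : nat)
    (P' Q' : fact -> Prop) (m' : nat) : Prop :=
  [/\ forall f, P' f -> P f \/ f = (v, d),
      forall f, Q f -> Q' f \/ f.2 = d.+1 /\ adj v f.1,
      Q' (v, d) \/ exists2 f, P f & f.2.+1 = d /\ adj f.1 v
    & m' = m + (v \notin R)].

Definition scan_step n v P Q m P' Q' m' : Prop :=
  skips v P Q m P' Q' m' \/ exists2 d, d < n & takes v d P Q m P' Q' m'.

Section Sound.
Variables (n D : nat) (rho : V) (ord : nat -> V).
Variables (P Q : nat -> fact -> Prop) (m : nat -> nat).
Hypothesis P0 : forall f, P 0 f -> f = (rho, 0).
Hypothesis Qn : forall f, Q n f -> f = (rho, 0).
Hypothesis steps : forall i, i < n ->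
  scan_step D (ord i) (P i) (Q i) (m i) (P i.+1) (Q i.+1) (m i.+1).

Let supported (F : fact -> Prop) (f : fact) :=
  exists g, [/\ F g \/ g = (rho, 0), g.2.+1 = f.2 & adj g.1 f.1].

(** [F] is the set of all facts taken so far, which the states themselves do not remember, and [X]
    is the set of their vertices. *)
Let scan_inv i (F : fact -> Prop) (X : {set V}) :=
  [/\ (forall f, F f -> f.1 \in X) /\ (forall x, x \in X -> exists d, F (x, d)),
      #|X :\: R| <= m i,
      forall j, j < i -> ord j \in R -> ord j \in X,
      forall f, P i f -> F f \/ f = (rho, 0)
    & forall f, F f -> Q i f \/ supported F f].

Lemma scan_invP i : i <= n -> exists F X, scan_inv i F X.
Proof.
elim: i => [|i IHi] hi.
  exists (fun _ => False), finset.set0; split=> //.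
  - by split=> // x; rewrite finset.inE.
  - by rewrite finset.set0D cards0.
  - by move=> f /P0; right.
have [F [X [[FX XF] cX RX hP hQ]]] := IHi (ltnW hi).
have [[vR PP QQ em]|[d _ [PP QQ vd em]]] := steps hi.
  exists F, X; split=> //; first by rewrite em.
  - move=> j; rewrite ltnS leq_eqVlt => /orP[/eqP->|]; last exact: RX.
    by rewrite (negbTE vR).
  - by move=> f /PP /hP.
  - by move=> f /hQ[/QQ|]; [left|right].
set v := ord i.
exists (fun f => F f \/ f = (v, d)), (v |: X); split.
- split=> [f [/FX fX|->]|x]; first by rewrite !finset.inE fX orbT.
    by rewrite !finset.inE eqxx.
  by rewrite !finset.inE => /orP[/eqP->|/XF[e Fe]]; [exists d; right|exists e; left].
- apply: (@leq_trans #|(X :\: R) :|: (if v \notin R then [set v] else finset.set0)|).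
    apply/subset_leq_card/fintype.subsetP => x; rewrite !finset.inE.
    case/andP=> xR /orP[/eqP xv|->]; last by rewrite xR.
    by rewrite -xv xR finset.inE eqxx orbT.
  rewrite em -/v; apply: leq_trans (leq_card_setU _ _) _; apply: leq_add => //.
  by case: ifP => _; rewrite ?cards1 ?cards0.
- move=> j; rewrite ltnS leq_eqVlt finset.in_setU1 => /orP[/eqP->|ji jR]; first by rewrite eqxx.
  by rewrite RX ?orbT.
- by move=> f /PP[/hP[]|->]; [left; left|right|left; right].
- move=> f [/hQ[/QQ[|[e a]]|[g [h1 h2 h3]]]|->]; first by left.
  + by right; exists (v, d); split=> //; left; right.
  + by right; exists g; split=> //; case: h1; [left; left|right].
  + case: vd => [|[g /hP hg [e a]]]; [by left|right; exists g; split=> //].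
    by case: hg; [left; left|right].
Qed.

Hypothesis rhoR : rho \in R.
Hypothesis ordR : forall v, v \in R -> exists2 i, i < n & ord i = v.

(** A vertex may have been taken at several distances; the least one is kept. The fact supporting it
    has a smaller distance, and so does the least fact of the supporting vertex. *)
Lemma scan_sound : exists (X : {set V}) (d : V -> nat),
  [/\ R \subset X, #|X :\: R| <= m n
    & forall v, v \in X -> v != rho -> exists u, [/\ u \in X, adj u v & d u < d v]].
Proof.
have [F [X [[FX XF] cX RX _ hQ]]] := scan_invP (leqnn n).
have RsX : R \subset X.
  by apply/fintype.subsetP => v vR; have [i hi iv] := ordR vR; rewrite -iv RX ?iv.
pose F' f := F f \/ f = (rho, 0).
(* The second disjunct only makes the minimum exist outside [X]. *)
have ex v : exists d, `[< F' (v, d) >] || (v \notin X).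
  case: (boolP (v \in X)) => [/XF[d Fd]|_]; last by exists 0; rewrite orbT.
  by exists d; rewrite orbF; apply/asboolP; left.
exists X, (fun v => ex_minn (ex v)); split=> // v vX vr.
case: ex_minnP => d; rewrite vX orbF => /asboolP [Fd|[/eqP]]; last by rewrite (negbTE vr).
move=> dmin; have [/Qn[/eqP]|[[u e] /= [Fu /= ed a]]] := hQ _ Fd; first by rewrite (negbTE vr).
exists u; split=> //.
  case: Fu => [/FX //|[-> _]]; exact: (fintype.subsetP RsX).
case: ex_minnP => e' _ /(_ e); rewrite -ed ltnS; apply.
by apply/orP; left; apply/asboolP.
Qed.
End Sound.
End Scan.

(** * Trees from decreasing distances *)

Section Tree.
Local Open Scope nat_scope.
Variables (V : finType) (e : rel V) (R X : {set V}) (rho : V) (d : V -> nat).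
Hypotheses (esym : symmetric e) (rhoX : rho \in X).
Hypothesis parent : forall v, v \in X -> v != rho ->
  exists u, [/\ u \in X, e u v & d u < d v].

(** One parent is chosen for each vertex of [X] other than [rho]; the decrease of [d] makes every
    chain of parents end at [rho] and forbids cycles. *)
Lemma steiner_yes_of_parents k : R \subset X -> #|X :\: R| <= k -> steiner_yes e R k.
Proof.
move=> RX cX.
pose isp v u := [&& u \in X, e u v & d u < d v].
pose par v := odflt rho [pick u | isp v u].
have parP v : v \in X -> v != rho -> isp v (par v).
  move=> vX vr; rewrite /par; case: pickP => //= no.
  by have [u [uX euv duv]] := parent vX vr; have := no u; rewrite /isp uX euv duv.
pose arc u v := [&& u \in X, u != rho & par u == v].
pose eT u v := arc u v || arc v u.
have arcP u v : arc u v -> [/\ u \in X, v \in X, e v u & d v < d u].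
  by case/and3P=> uX ur /eqP <-; have /and3P[] := parP u uX ur.
have eTsym : symmetric eT by move=> u v; rewrite /eT orbC.
exists X, eT; split=> //.
- split=> // u v /orP[] /arcP[h1 h2 h3 _]; first by rewrite h1 h2 esym.
  by rewrite h1 h2.
- split; first by apply/set0Pn; exists rho.
    have cr v : v \in X -> connect eT v rho.
      move: {2}(d v) (leqnn (d v)) => j; elim: j v => [|j IHj] v dj vX.
        have [->//|vr] := eqVneq v rho.
        by have /and3P[_ _] := parP v vX vr; rewrite ltnNge (leq_trans dj).
      have [->//|vr] := eqVneq v rho; have /and3P[pX _ pd] := parP v vX vr.
      apply: connect_trans (IHj (par v) _ pX); last by rewrite -ltnS (leq_trans pd).
      by apply: connect1; rewrite /eT /arc vX vr eqxx.
    move=> u v uX vX; apply: connect_trans (cr u uX) _.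
    by rewrite (sym_connect_sym eTsym) cr.
  (* Both neighbours on a cycle of a vertex maximizing d would be its parent. *)
  move=> p /andP[cyc un]; rewrite leqNgt; apply/negP => p2.
  have [x0 px0] : exists x0, x0 \in p by case: p p2 {cyc un} => // x0 p _; exists x0; exact: mem_head.
  have [x xp xmax] := arg_maxnP d px0.
  have [i s ps] := rot_to xp.
  move: cyc un p2; rewrite -(rot_cycle i) -(rot_uniq i) -(size_rot i) ps.
  have dmax y : y \in x :: s -> d y <= d x by rewrite -ps mem_rot; exact: xmax.
  case: s {ps} dmax => // y [|z s] // dmax /= /andP[xy].
  rewrite rcons_path => /andP[_ /andP[_ zx]] /andP[_ /andP[yzs _]] _.
  have px u : u \in [:: x, y, z & s] -> eT x u -> par x = u.
    move=> uin /orP[/and3P[_ _ /eqP //]|/arcP[_ _ _]].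
    by rewrite ltnNge dmax.
  have ey : par x = y by apply: px => //; rewrite !inE eqxx orbT.
  have ez : par x = last z s.
    by apply: px; [rewrite 2!in_cons mem_last !orbT|rewrite eTsym].
  by move: yzs; rewrite -ey ez mem_last.
Qed.
End Tree.

(** * Distances from a root *)

Section Bfs.
Local Open Scope nat_scope.
Variables (V : finType) (e : rel V) (rho : V).

Definition walk_to (v : V) (l : nat) : bool :=
  [exists p : l.-tuple V, path e rho p && (last rho p == v)].

(** The value is [#|V|] on unreachable vertices; a reachable one has a walk without repetitions,
    hence of length below [#|V|]. *)
Definition bfs (v : V) : nat := find (walk_to v) (iota 0 #|V|).

Lemma walk_toP v l :
  reflect (exists p, [/\ size p = l, path e rho p & last rho p = v]) (walk_to v l).
Proof.
apply: (iffP existsP) => [[p /andP[pp /eqP pv]]|[p [pl pp pv]]].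
  by exists p; rewrite size_tuple.
by move/eqP: pl => pl; exists (Tuple pl); rewrite /= pp pv eqxx.
Qed.

Lemma bfs_le v l : walk_to v l -> l < #|V| -> bfs v <= l.
Proof.
move=> vl ln; rewrite /bfs leqNgt; apply/negP => /(before_find 0).
by rewrite nth_iota // add0n vl.
Qed.

Lemma bfsP v : connect e rho v -> walk_to v (bfs v) /\ bfs v < #|V|.
Proof.
case/connectP=> p0 pp0 pv.
have [l [ln vl]] : exists l, l < #|V| /\ walk_to v l.
  case/shortenP: pp0 pv => p pp un _ pv; exists (size p); split; last first.
    by apply/walk_toP; exists p.
  by have := max_card (mem (rho :: p)); rewrite (card_uniqP un).
have h : has (walk_to v) (iota 0 #|V|).
  by apply/hasP; exists l; rewrite // mem_iota.
have lt : bfs v < #|V| by rewrite -[X in _ < X](size_iota 0) -has_find.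
by split=> //; have := nth_find 0 h; rewrite nth_iota.
Qed.

Lemma bfs_root : bfs rho = 0.
Proof.
apply/eqP; rewrite -leqn0; apply: bfs_le; first by apply/walk_toP; exists [::].
by apply/card_gt0P; exists rho.
Qed.

Lemma bfs_parent v : connect e rho v -> v != rho ->
  exists u, [/\ connect e rho u, e u v & (bfs u).+1 = bfs v].
Proof.
move=> cv vr; have [/walk_toP[p [ps pp pv]] lt] := bfsP cv.
case/lastP: p ps pp pv => [|p w]; first by move=> _ _ /= h; rewrite h eqxx in vr.
rewrite size_rcons last_rcons rcons_path => ps /andP[pp ew] wv; subst w.
set u := last rho p in ew.
have cu : connect e rho u by apply/connectP; exists p.
exists u; split=> //; apply/eqP; rewrite eqn_leq; apply/andP; split.
  rewrite -ps ltnS; apply: bfs_le; first by apply/walk_toP; exists p.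
  by rewrite ltnW // ps.
have [/walk_toP[q [qs qp qu]] _] := bfsP cu.
(* [bfs_le] only covers walks shorter than [#|V|]; beyond that length the bound on [bfs v] from
   [bfsP] is enough. *)
have [h|h] := ltnP (bfs u).+1 #|V|; last exact: leq_trans (ltnW lt) h.
apply: bfs_le => //; apply/walk_toP; exists (rcons q v).
by rewrite size_rcons qs last_rcons rcons_path qp qu ew.
Qed.
End Bfs.

(** * The states that a solution induces *)

Section Complete.
Local Open Scope nat_scope.
Variables (V : finType) (adj H : rel V) (R X : {set V}) (rho : V).
Variables (rank : V -> nat) (ord : nat -> V) (d : V -> nat) (n D : nat).
Hypotheses (RX : R \subset X) (rhoX : rho \in X) (d0 : d rho = 0).
Hypotheses (rankK : forall v, ord (rank v) = v) (ordK : forall i, i < n -> rank (ord i) = i).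
Hypothesis rank_lt : forall v, rank v < n.
Hypotheses (Hsym : symmetric H) (Hadj : forall u v, H u v -> adj u v).
Hypothesis d_lt : forall v, v \in X -> d v < D.
Hypothesis parent : forall v, v \in X -> v != rho ->
  exists u, [/\ u \in X, H u v & (d u).+1 = d v].

Definition active i : {set V} :=
  [set u in X | (rank u < i) && [exists v in X, (i <= rank v) && H u v]].

Let par v := odflt rho [pick u | [&& u \in X, H u v & (d u).+1 == d v]].

Let parP v : v \in X -> v != rho -> [/\ par v \in X, H (par v) v & (d (par v)).+1 = d v].
Proof.
move=> vX vr; rewrite /par; case: pickP => [u /and3P[? ? /eqP ?]|no] //=.
by have [u [uX h /eqP du]] := parent vX vr; have := no u; rewrite uX h du.
Qed.

Definition demands i : {set V} :=
  [set u in X | [&& rank u < i, u != rho & i <= rank (par u)]].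

(** Parents are chosen along the sparse relation [H], so a scanned vertex still waiting for its
    parent has an [H]-edge across the front. One bound on active vertices then serves both lists. *)
Lemma demands_active i : demands i \subset active i.
Proof.
apply/fintype.subsetP => u; rewrite !finset.inE => /and4P[uX -> ur ip].
rewrite uX /=; have [pX h _] := parP uX ur.
by apply/existsP; exists (par u); rewrite pX ip Hsym.
Qed.

Definition facts_of (A : {set V}) (f : fact V) : Prop :=
  f.1 \in rho |: A /\ f.2 = d f.1.

Definition spent i : nat := #|[set u in X | (u \notin R) && (rank u < i)]|.

Let rank_eq v i : i < n -> (rank v == i) = (v == ord i).
Proof. by move=> hi; apply/eqP/eqP => [<-|->]; rewrite ?rankK ?ordK. Qed.

Let rankS v i : i < n -> (rank v < i.+1) = (v == ord i) || (rank v < i).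
Proof. by move=> hi; rewrite ltnS leq_eqVlt rank_eq. Qed.

Let gt_rank v i : i < n -> v != ord i -> i <= rank v -> i < rank v.
Proof. by move=> hi; rewrite -rank_eq // leq_eqVlt eq_sym => /negbTE ->. Qed.

(** If the parent of [v] is already scanned, its edge to [v] makes it active and its fact is at
    hand; otherwise [v] becomes a demand. A demand disappears only when its parent is scanned, and
    parents are in [X], so nothing is lost by skipping a vertex outside [X]. *)
Lemma scan_complete i : i < n ->
  scan_step adj R D (ord i) (facts_of (active i)) (facts_of (demands i)) (spent i)
    (facts_of (active i.+1)) (facts_of (demands i.+1)) (spent i.+1).
Proof.
move=> hi; set v := ord i; have rv : rank v = i by rewrite ordK.
have spentS : spent i.+1 = spent i + ((v \in X) && (v \notin R)).
  rewrite /spent (cardsD1 v) addnC !finset.inE rankS // eqxx andbT; congr (_ + _).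
  apply: eq_card => u; rewrite !finset.inE rankS //.
  by have [->|] := eqVneq u (ord i); rewrite //= -/v rv ltnn !andbF.
have actS u : u \in active i.+1 -> u \in active i \/ u = v.
  rewrite !finset.inE rankS // => /and3P[uX /orP[/eqP->|ui] /existsP[w /and3P[wX iw h]]].
    by right.
  by left; rewrite uX ui; apply/existsP; exists w; rewrite wX h ltnW.
have demS u : u \in demands i -> u \in demands i.+1 \/ v \in X /\ u != rho /\ par u = v.
  rewrite !finset.inE rankS // => /and4P[uX ui ur ip].
  have [pX _ _] := parP uX ur.
  have [e|e] := eqVneq (par u) v; first by right; rewrite -e.
  by left; rewrite uX ui ur (gt_rank hi e ip) orbT.
case: (boolP (v \in X)) => vX; [right|left]; last first.
  split.
  - by apply: contra vX => /(fintype.subsetP RX).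
  - move=> [u du] [/= fA ->]; split=> //=; move: fA; rewrite !finset.in_setU1 => /orP[->//|fA].
    case: (actS _ fA) => [->|e]; rewrite ?orbT //.
    by move: fA vX; rewrite finset.inE e => /andP[->].
  - move=> [u du] [/= fA ->]; split=> //=; move: fA; rewrite !finset.in_setU1 => /orP[->//|fA].
    by case: (demS _ fA) => [->|[vX' _]]; rewrite ?orbT //; move: vX; rewrite vX'.
  - by rewrite spentS (negbTE vX) addn0.
exists (d v); first exact: d_lt.
split.
- move=> [u du] [/= uA ->]; move: uA; rewrite finset.in_setU1 => /orP[/eqP->|uA].
    by left; split; rewrite ?finset.setU11.
  by case: (actS _ uA) => [h|->]; [left; split; rewrite //= finset.in_setU1 h orbT|right].
- move=> [u du] [/= uA ->]; move: uA; rewrite finset.in_setU1 => /orP[/eqP->|uA].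
    by left; split; rewrite ?finset.setU11.
  case: (demS _ uA) => [h|[_ [ur pu]]]; [left; split; rewrite //= finset.in_setU1 h orbT //|right].
  have uX : u \in X by move: uA; rewrite finset.inE => /andP[].
  by have [_ /Hadj h <-] := parP uX ur; rewrite -pu.
- have [vr|vr] := eqVneq v rho; first by left; split; rewrite /= ?vr ?finset.setU11.
  have [pX h dp] := parP vX vr.
  (* A parent not yet scanned comes strictly after [v], so [v] is a demand of the next state. *)
  have pv : par v != v by apply: contra_eq_neq dp => ->; rewrite -[X in _ != X]addn0 -addn1 eqn_add2l.
  have [pi|pi] := ltnP (rank (par v)) i; last first.
    left; split=> //=; rewrite finset.in_setU1; apply/orP; right.
    by rewrite finset.inE vX rv ltnSn vr gt_rank.
  right; exists (par v, d (par v)); last by split=> //; exact: Hadj.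
  split=> //=; rewrite finset.in_setU1; apply/orP; right.
  by rewrite finset.inE pX pi; apply/existsP; exists v; rewrite vX rv leqnn h.
- by rewrite spentS vX.
Qed.

Lemma facts_of_start f : facts_of (active 0) f -> f = (rho, 0).
Proof.
case: f => u du [/= + ->]; rewrite finset.in_setU1 => /orP[/eqP->|]; first by rewrite d0.
by rewrite finset.inE ltn0 andbF.
Qed.

Lemma facts_of_end f : facts_of (demands n) f -> f = (rho, 0).
Proof.
case: f => u du [/= + ->]; rewrite finset.in_setU1 => /orP[/eqP->|]; first by rewrite d0.
by rewrite finset.inE => /and4P[_ _ _]; rewrite leqNgt rank_lt.
Qed.

Lemma spent0 : spent 0 = 0.
Proof. by apply: eq_card0 => u; rewrite finset.inE ltn0 !andbF. Qed.

Lemma spent_end : spent n = #|X :\: R|.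
Proof. by apply: eq_card => u; rewrite !finset.inE rank_lt andbT andbC. Qed.

End Complete.

(** * A sparse connected subgraph on a set covered by clique cells *)

Section Sparse.
Local Open Scope nat_scope.
Variables (V : finType) (adj : rel V) (X : {set V}) (cell : V -> nat * nat) (rank : V -> nat).
Hypotheses (adj_sym : symmetric adj) (rank_inj : injective rank).
Hypothesis clique : {in X &, forall u v, cell u = cell v -> adj u v}.

(** The centre of the star of a cell. Taking the least rank ensures that when an edge of the star
    crosses the front, its scanned end is the centre, so the star contributes one active vertex and
    not many leaves. *)
Definition leader u : bool :=
  (u \in X) && [forall v in X, (cell u == cell v) ==> (rank u <= rank v)].

(** The pair is chosen separately for the two orders of the cells, hence two link ends besides the
    leader in [ends]. *)
Definition link (Q Q' : nat * nat) : option (V * V) :=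
  [pick p : V * V | [&& p.1 \in X, p.2 \in X, cell p.1 == Q, cell p.2 == Q' & adj p.1 p.2]].

Definition sparse : rel V := fun u v =>
  [&& u \in X, v \in X & [|| (cell u == cell v) && (leader u || leader v),
    link (cell u) (cell v) == Some (u, v) | link (cell v) (cell u) == Some (v, u)]].

Lemma sparse_sym : symmetric sparse.
Proof.
move=> u v; rewrite /sparse andbCA [cell v == _]eq_sym [leader v || _]orbC.
by rewrite [(_ == Some (v, u)) || _]orbC.
Qed.

Lemma link_adj Q Q' u v : link Q Q' = Some (u, v) ->
  [/\ u \in X, v \in X, cell u = Q, cell v = Q' & adj u v].
Proof. by rewrite /link; case: pickP => // [[a b]] /and5P[? ? /eqP ? /eqP ? ?] [<- <-]. Qed.

Lemma sparse_adj u v : sparse u v -> adj u v.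
Proof.
case/and3P=> uX vX /or3P[/andP[/eqP cuv _]|/eqP /link_adj[]|/eqP /link_adj[]] //.
  exact: clique.
by rewrite adj_sym.
Qed.

Lemma leader_exists u : u \in X -> exists v, leader v /\ cell v = cell u.
Proof.
move=> uX; have Pu : [pred v in X | cell v == cell u] u by rewrite /= uX /=.
have [v /andP[vX /eqP cv] vmin] := arg_minnP rank Pu.
exists v; split=> //; rewrite /leader vX; apply/forall_inP => w wX.
by apply/implyP => /eqP vw; apply: vmin; rewrite /= wX -vw cv /=.
Qed.

(** The edge is replaced by the link of its two cells, which is reached inside each cell through the
    leader. *)
Lemma connect_sparse u v : u \in X -> v \in X -> adj u v -> connect sparse u v.
Proof.
move=> uX vX uv.
have cc a b : a \in X -> b \in X -> cell a = cell b -> connect sparse a b.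
  move=> aX bX ab; have [z [lz cz]] := leader_exists aX.
  have zX : z \in X by case/andP: lz.
  apply: (@connect_trans _ _ z); apply: connect1; rewrite /sparse aX || rewrite /sparse.
    by rewrite zX cz eqxx lz orbT.
  by rewrite zX bX cz ab eqxx lz.
case E: (link (cell u) (cell v)) => [[a b]|]; last first.
  by move: E; rewrite /link; case: pickP => // /(_ (u, v)); rewrite /= uX vX uv !eqxx.
have [aX bX ca cb ab] := link_adj E.
apply: connect_trans (cc _ _ uX aX (esym ca)) _; apply: connect_trans (cc _ _ bX vX cb).
by apply: connect1; rewrite /sparse aX bX ca cb E eqxx orbT.
Qed.

Lemma leader_uniq u v : leader u -> leader v -> cell u = cell v -> u = v.
Proof.
case/andP=> uX /forall_inP lu /andP[vX /forall_inP lv] uv; apply: rank_inj; apply/eqP.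
have := lu v vX; have := lv u uX; rewrite uv eqxx /= => h1 h2.
by rewrite eqn_leq h1 h2.
Qed.

Let ends (Q : (nat * nat) * (nat * nat)) : seq V :=
  pmap id [:: [pick u | leader u && (cell u == Q.1)];
    omap fst (link Q.1 Q.2); omap snd (link Q.2 Q.1)].

(* A processed vertex with a sparse edge to an unprocessed one is the leader of
   its cell or an end of the link between the two cells. *)
Lemma card_active (i : nat) (T : seq ((nat * nat) * (nat * nat))) :
    (forall u v, u \in X -> v \in X -> adj u v -> rank u < i -> i <= rank v ->
       (cell u, cell v) \in T) ->
  #|active sparse X rank i| <= 3 * size T.
Proof.
move=> hT; apply: (@leq_trans (size (flatten [seq ends Q | Q <- T]))); last first.
  elim: T {hT} => //= Q T IHT; rewrite size_cat mulnS leq_add //.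
  by rewrite size_pmap count_size.
apply: leq_trans (card_size _); apply/subset_leq_card/fintype.subsetP => u.
rewrite finset.inE => /and3P[uX ui /existsP[v /and3P[vX iv uv]]].
apply/flatten_mapP; exists (cell u, cell v); first exact: hT (sparse_adj uv) _ _.
rewrite mem_pmap map_id !inE.
case/and3P: uv => _ _ /or3P[/andP[/eqP cuv lead]|/eqP->|/eqP->]; rewrite ?eqxx ?orbT //.
have lu : leader u.
  case/orP: lead => // /andP[_ /forall_inP /(_ u uX)]; rewrite cuv eqxx /= => h.
  by move: (leq_ltn_trans h ui); rewrite ltnNge iv.
case: pickP => [w /andP[lw /eqP cw]|/(_ u)]; last by rewrite lu eqxx.
by rewrite (leader_uniq lu lw (esym cw)) eqxx.
Qed.
End Sparse.

(** * Scanning order from real keys *)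

Section Rank.
Variables (K : realType) (n : nat) (key : 'I_n -> K).

(** The lexicographic order by key and index: ties are broken by index, so that ranks are distinct
    even when keys coincide. *)
Definition before (u v : 'I_n) : bool :=
  if (u < v)%N then key u <= key v else key u < key v.

Definition rank (v : 'I_n) : nat := #|[set u | before u v]|.

Lemma before_irr v : before v v = false.
Proof. by rewrite /before ltnn ltxx. Qed.

Lemma before_trans : transitive before.
Proof.
move=> v u w; rewrite /before.
case: (ltnP u v) => uv; case: (ltnP v w) => vw; case: (ltnP u w) => uw h1 h2;
  first [by lia | exact: le_trans h1 h2 | exact: lt_trans h1 h2
    | exact: lt_le_trans h1 h2 | exact: le_lt_trans h1 h2
    | exact: ltW (le_lt_trans h1 h2) | exact: ltW (lt_le_trans h1 h2)
    | exact: ltW (lt_trans h1 h2)].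
Qed.

Lemma before_total u v : u != v -> before u v || before v u.
Proof.
move=> uv; rewrite /before; case: (ltngtP u v) => [_|_|/val_inj /eqP].
- by case: (leP (key u)).
- by rewrite orbC; case: (leP (key v)).
- by rewrite (negbTE uv).
Qed.

Lemma rank_lt v : (rank v < n)%N.
Proof.
rewrite -[X in (_ < X)%N]card_ord -cardsT; apply: proper_card.
by apply/properP; split; [exact: finset.subsetT|exists v; rewrite !finset.inE // before_irr].
Qed.

Lemma before_rank u v : before u v -> (rank u < rank v)%N.
Proof.
move=> uv; apply: proper_card; apply/properP; split.
  by apply/fintype.subsetP => w; rewrite !finset.inE => /before_trans; apply.
by exists u; rewrite !finset.inE // before_irr.
Qed.

Lemma rank_inj : injective rank.
Proof.
move=> u v e; apply/eqP; apply: contraT => /before_total /orP[] /before_rank;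
  by rewrite e ltnn.
Qed.

Lemma rank_key u v : (rank u <= rank v)%N -> key u <= key v.
Proof.
have [->//|uv] := eqVneq u v; case/orP: (before_total uv).
  by rewrite /before; case: ifP => // _ /ltW.
by move/before_rank; case: ltnP.
Qed.

Definition unrank (v0 : 'I_n) (i : nat) : 'I_n := odflt v0 [pick v | rank v == i].

Lemma rankK v0 v : unrank v0 (rank v) = v.
Proof.
by rewrite /unrank; case: pickP => [u /eqP /rank_inj //|/(_ v)]; rewrite eqxx.
Qed.

Lemma unrankK v0 i : (i < n)%N -> rank (unrank v0 i) = i.
Proof.
move=> hi; pose f v : 'I_n := Ordinal (rank_lt v).
have fi : injective f by move=> u v [/rank_inj].
have [g _ gK] := injF_bij fi.
rewrite /unrank; case: pickP => [u /eqP //|/(_ (g (Ordinal hi)))].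
by have /(congr1 val) /= -> := gK (Ordinal hi); rewrite eqxx.
Qed.
End Rank.

(** * Cells and strips *)

Section Geometry.
Variables (K : realType) (n : nat) (c : 'I_n -> K * K) (rho : 'I_n).

Definition near : rel 'I_n := fun u v =>
  ((c u).1 - (c v).1) ^+ 2 + ((c u).2 - (c v).2) ^+ 2 <= 4.

Lemma near_sym : symmetric near.
Proof. by move=> u v; rewrite /near -sqrrN opprB -[(_.2 - _) ^+ 2]sqrrN opprB. Qed.

Lemma disk_graphE u v : disk_graph c u v = (u != v) && near u v.
Proof.
rewrite /disk_graph; congr (_ && _); apply/asboolP/idP.
  rewrite /near; case: (c u) (c v) => [a b] [a' b'] [[x y] []]; rewrite /unit_disk /= => h1 h2.
  (* By the parallelogram identity, the squared distance of the centres is at most twice the sum of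
     their squared distances to the common point, hence at most 4. *)
  have := sqr_ge0 (x - a + (x - a')); have := sqr_ge0 (y - b + (y - b')).
  by nra.
rewrite /near; case: (c u) (c v) => [a b] [a' b'] /= h.
by exists ((a + a') / 2, (b + b') / 2); split; rewrite /unit_disk /=; nra.
Qed.

Lemma near_dist u v : near u v ->
  `|(c u).1 - (c v).1| <= 2 /\ `|(c u).2 - (c v).2| <= 2.
Proof.
rewrite /near; set a := _ - _; set b := _ - _ => h.
have ha : 0 <= a ^+ 2 by exact: sqr_ge0.
have hb : 0 <= b ^+ 2 by exact: sqr_ge0.
by split; rewrite -ler_sqr ?nnegrE // real_normK ?num_real //; lra.
Qed.

Variable X : {set 'I_n}.
Hypothesis rhoX : rho \in X.

Definition near_in : rel 'I_n := fun u v => [&& u \in X, v \in X & near u v].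

Hypothesis X_connected : {in X, forall v, connect near_in rho v}.

(** An edge moves a coordinate by at most 2 and a vertex of the solution is fewer than [n] edges
    away from [rho]. Adding [2 * n] thus makes coordinates nonnegative on the solution, where
    truncation is the floor. *)
Definition xpos v : K := (c v).1 - (c rho).1 + (2 * n)%:R.
Definition ypos v : K := (c v).2 - (c rho).2 + (2 * n)%:R.

Lemma pos_bounds v : v \in X ->
  (0 <= xpos v <= (4 * n)%:R) /\ (0 <= ypos v <= (4 * n)%:R).
Proof.
set e := near_in.
have dist : forall l w, w \in X -> bfs e rho w = l ->
    `|(c w).1 - (c rho).1| <= (2 * l)%:R /\ `|(c w).2 - (c rho).2| <= (2 * l)%:R.
  elim=> [|l IHl] w wX bw.
    have [->|wr] := eqVneq w rho; first by rewrite !subrr normr0.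
    by have [u [_ _]] := bfs_parent (X_connected wX) wr; rewrite bw.
  have [wr|wr] := eqVneq w rho; first by move: bw; rewrite wr bfs_root.
  have [u [_ /and3P[uX _ /near_dist[hx hy]] bu]] := bfs_parent (X_connected wX) wr.
  have [||hx' hy'] := IHl u; [by []|by move: bu; rewrite bw => -[]|].
  rewrite mulnS natrD; split.
    have -> : (c w).1 - (c rho).1 = ((c u).1 - (c rho).1) - ((c u).1 - (c w).1) by ring.
    by apply: le_trans (ler_normB _ _) _; lra.
  have -> : (c w).2 - (c rho).2 = ((c u).2 - (c rho).2) - ((c u).2 - (c w).2) by ring.
  by apply: le_trans (ler_normB _ _) _; lra.
move=> vX; have [_ lt] := bfsP (X_connected vX).
have {lt} : (2 * bfs e rho v)%:R <= (2 * n)%:R :> K.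
  by rewrite ler_nat leq_mul2l ltnW // -[X in (_ < X)%N](card_ord n).
have [||] := dist (bfs e rho v) v => //; rewrite /xpos /ypos.
have -> : (4 * n)%:R = (2 * n)%:R + (2 * n)%:R :> K by rewrite -natrD; congr _%:R; lia.
rewrite !ler_norml => /andP[? ?] /andP[? ?] ?.
by split; apply/andP; split; lra.
Qed.

Definition col v : nat := Num.truncn (xpos v).
Definition row v : nat := Num.truncn (ypos v).

Lemma truncn_diff (x y : K) : 0 <= x -> 0 <= y -> `|x - y| <= 2 ->
  (Num.truncn x <= Num.truncn y + 2)%N.
Proof.
move=> x0 y0; rewrite ler_norml => /andP[h1 h2].
have /andP[a1 a2] := Num.Theory.truncn_itv x0; have /andP[b1 b2] := Num.Theory.truncn_itv y0.
rewrite -ltnS -(ltr_nat K); apply: le_lt_trans a1 _.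
by rewrite -addSn natrD; lra.
Qed.

Lemma near_cells u v : u \in X -> v \in X -> near u v ->
  [/\ (col u <= col v + 2)%N, (col v <= col u + 2)%N,
      (row u <= row v + 2)%N & (row v <= row u + 2)%N].
Proof.
move=> /pos_bounds[/andP[xu _] /andP[yu _]] /pos_bounds[/andP[xv _] /andP[yv _]].
move=> /near_dist[hx hy].
have ex : xpos u - xpos v = (c u).1 - (c v).1 by rewrite /xpos; ring.
have ey : ypos u - ypos v = (c u).2 - (c v).2 by rewrite /ypos; ring.
by split; apply: truncn_diff; rewrite // ?ex ?ey // distrC ?ex ?ey.
Qed.

Lemma cell_near u v : u \in X -> v \in X ->
  (col u, row u) = (col v, row v) -> near u v.
Proof.
move=> /pos_bounds[/andP[xu _] /andP[yu _]] /pos_bounds[/andP[xv _] /andP[yv _]] [ex ey].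
have /andP[+ +] := Num.Theory.truncn_itv xu; have /andP[+ +] := Num.Theory.truncn_itv xv.
have /andP[+ +] := Num.Theory.truncn_itv yu; have /andP[+ +] := Num.Theory.truncn_itv yv.
rewrite -/(col u) -/(col v) -/(row u) -/(row v) ex ey !mulrSr /near /xpos /ypos => *.
set a := (c u).1 - (c v).1; set b := (c u).2 - (c v).2.
(* Both differences are at most 1 in absolute value; the products state this as a bound on their
   squares. *)
have ha : 0 <= (1 - a) * (1 + a) by apply: mulr_ge0; rewrite /a; lra.
have hb : 0 <= (1 - b) * (1 + b) by apply: mulr_ge0; rewrite /b; lra.
by nra.
Qed.
(** [S] bounds the number of strip boundaries to compare with; across the width [4 * n] of a
    solution, [2 * n + 1] of them suffice. In the program it is the number of codes, a loop bound
    that is at hand. *)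
Variables (w S : nat).
Hypotheses (w_gt0 : (0 < w)%N) (S_large : (2 * n + 1 <= S)%N).

(* The index of the strip of v, computed without rounding. *)
Definition phase r v : nat :=
  count (fun i => (2 * w * i.+1)%:R <= (c v).1 - (c rho).1 + (2 * n + 2 * r)%:R) (iota 0 S).

(* The factor 5n exceeds the height 4n of a solution, so that on a solution the
   key orders first by strip. *)
Definition key r v : K := (c v).2 + (5 * n * phase r v)%:R.

Lemma count_multiples W M m : (0 < W)%N -> (M %/ W <= m)%N ->
  count (fun i => W * i.+1 <= M)%N (iota 0 m) = (M %/ W)%N.
Proof.
move=> W0 Mm; rewrite -size_filter (eq_filter (a2 := fun i => i < M %/ W)%N).
  by have := filter_iota_ltn 0 Mm; rewrite add0n => ->; rewrite size_iota.
by move=> i; rewrite leq_divRL // mulnC.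
Qed.

(** Boundaries and shifts are integers, so comparing them with [xpos v] or with its floor is the
    same, and counting multiples of [2 * w] yields the quotient. *)
Lemma phaseE r v : (r < w)%N -> v \in X -> phase r v = ((col v + 2 * r) %/ (2 * w))%N.
Proof.
move=> rw vX; have [/andP[x0 x1] _] := pos_bounds vX.
have colle : (col v <= 4 * n)%N by rewrite -(ler_nat K); apply: le_trans x1; rewrite truncn_le.
rewrite -(@count_multiples _ _ S); first last.
- apply: (@leq_trans (2 * n + 1)) => //; rewrite -ltnS ltn_divLR; nia.
- by rewrite muln_gt0.
apply: eq_count => i /=; have -> : (c v).1 - (c rho).1 + (2 * n + 2 * r)%:R = xpos v + (2 * r)%:R.
  by rewrite natrD /xpos addrA.
have [h|h] := leqP (2 * w * i.+1) (2 * r).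
  have -> : (2 * w * i.+1 <= col v + 2 * r)%N by lia.
  by apply: le_trans (_ : (2 * r)%:R <= _); rewrite ?ler_nat // lerDr.
rewrite -lerBlDr -natrB; last exact: ltnW.
by rewrite -(truncn_ge_nat _ x0) leq_subLR addnC.
Qed.

Definition light r : {set 'I_n} := [set v in X | ((col v + 2 * r) %% (2 * w) < 2)%N].

Lemma light_shift : (#|X| <= w * w)%N -> exists2 r, (r < w)%N & (#|light r| <= w)%N.
Proof.
move=> cX; suff [r hr] : exists r : 'I_w, (#|light r| <= w)%N by exists r.
apply/existsP; apply: contraT; rewrite negb_exists => /forallP h.
have : (\sum_(r < w) #|light r| <= #|X|)%N.
  rewrite -[leqRHS]sum1_card [leqRHS]big_mkcond /=.
  rewrite (eq_bigr (fun r : 'I_w => \sum_(v : 'I_n) if v \in light r then 1 else 0)%N); last first.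
    by move=> r _; rewrite -sum1_card big_mkcond.
  rewrite exchange_big /=; apply: leq_sum => v _.
  rewrite -big_mkcond sum1_card.
  have [vX|vX] := ifPn; last first.
    by rewrite leqn0; apply/eqP/eq_card0 => r; change (v \in light r = false); rewrite finset.inE (negbTE vX).
  (* A vertex is light for at most one shift: shifts move its residue modulo [2 * w] by even
     amounts, so two residues below 2 are equal, and then so are the shifts, both being below
     [w]. *)
  apply/card_le1P => r1 h1 r2; have {h1} : v \in light r1 by exact: h1.
  rewrite finset.inE vX /= => h1.
  change ((v \in light r2) = (r2 \in pred1 r1)); rewrite finset.inE vX inE /=; apply/idP/eqP => [h2|->//]; apply/val_inj => /=.
  move: h1 h2 (divn_eq (col v + 2 * r1) (2 * w)) (divn_eq (col v + 2 * r2) (2 * w)) (ltn_ord r1) (ltn_ord r2).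
  set q1 := (_ %/ _)%N; set q2 := (_ %/ _)%N; set a1 := (_ %% _)%N; set a2 := (_ %% _)%N.
  move=> h1 h2 e1 e2 l1 l2.
  clear -h1 h2 e1 e2 l1 l2; have [qq|qq|qq] := ltngtP q1 q2; nia.
have : (\sum_(r < w) w.+1 <= \sum_(r < w) #|light r|)%N.
  by apply: leq_sum => r _; rewrite ltnNge h.
rewrite sum_nat_const card_ord => h1 h2; move: (leq_trans h1 (leq_trans h2 cX)).
by rewrite mulnS -[X in (_ <= X)%N]add0n leq_add2r leqNgt w_gt0.
Qed.

Section Strip.
Variables (r : nat) (k0 : K).
Hypothesis rw : (r < w)%N.

Let n_gt0 : 0 < n%:R :> K.
Proof. by rewrite ltr0n (leq_ltn_trans _ (ltn_ord rho)). Qed.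

(** For [v] in [X], the key taken relative to [rho] is [5 * n * phase r v + ypos v] with
    [ypos v <= 4 * n]: dividing by [5 * n] recovers the strip, and the remainder gives the row. The
    scanned vertex may lie outside [X]; what matters is that [k0] separates keys of vertices in
    [X]. *)
Definition height : K := k0 - (c rho).2 + (2 * n)%:R.
Definition strip : nat := Num.truncn (height / (5 * n)%:R).
Definition level : nat := Num.truncn (height - (5 * n * strip)%:R).

(* k0 is the key of the vertex being scanned. *)
Definition near_strip : seq ((nat * nat) * (nat * nat)) :=
  [seq let: (a, b, p, q) := t in
     ((2 * w * strip + val a - 2 * r, level - val b),
      (2 * w * strip + val a - 2 * r + val p - 2, level - val b + val q - 2))%N
   | t <- enum {: 'I_(2 * w) * 'I_3 * 'I_5 * 'I_5}].

Definition near_light : seq ((nat * nat) * (nat * nat)) :=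
  [seq ((col v + val o.1 - 2, row v + val o.2 - 2)%N, (col v, row v))
   | v <- enum (light r), o <- enum {: 'I_5 * 'I_5}].

(** In [150 = 2 * 3 * 5 * 5], the factor 2 comes from the [2 * w] columns of a strip, 3 from the
    rows of the scanned end, at most two below the front, and [5 * 5] from the offset of the other
    end, between -2 and 2 in each direction and stored with 2 added. *)
Lemma size_near : size (near_strip ++ near_light) = (150 * w + 25 * #|light r|)%N.
Proof.
rewrite size_cat size_map size_allpairs [in RHS]cardE; move: (size (enum (light r))) => m.
by rewrite -!cardE !card_prod !card_ord; clear -w m; lia.
Qed.

Lemma front_cells u v : u \in X -> v \in X -> near u v -> key r u <= k0 -> k0 <= key r v ->
  ((col u, row u), (col v, row v)) \in near_strip ++ near_light.
Proof.
move=> uX vX uv ku kv; have [h1 h2 h3 h4] := near_cells uX vX uv.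
have [_ /andP[yu0 yu1]] := pos_bounds uX; have [_ /andP[yv0 yv1]] := pos_bounds vX.
move: ku kv; rewrite /key; set p := phase r u; set q := phase r v => ku kv.
have hu : (5 * n * p)%:R + ypos u <= height by rewrite /height /ypos; lra.
have hv : height <= (5 * n * q)%:R + ypos v by rewrite /height /ypos; lra.
have w2 : (0 < 2 * w)%N by rewrite muln_gt0.
have [a lu mu] : exists2 a, (a < 2 * w)%N & (col u + 2 * r = p * (2 * w) + a)%N.
  exists ((col u + 2 * r) %% (2 * w))%N; first by rewrite ltn_mod.
  by rewrite {1}(divn_eq (col u + 2 * r) (2 * w)) /p phaseE.
have [b lb mv] : exists2 b, (b < 2 -> v \in light r)%N & (col v + 2 * r = q * (2 * w) + b)%N.
  exists ((col v + 2 * r) %% (2 * w))%N; first by rewrite finset.inE vX.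
  by rewrite {1}(divn_eq (col v + 2 * r) (2 * w)) /q phaseE.
rewrite mem_cat; clearbody p q.
have [pq|pq|pq] := ltngtP p q; last first.
- apply/orP; left; rewrite -{}pq in hv mv kv *.
  have es : strip = p.
    apply: truncn_def; rewrite ler_pdivlMr ?ltr_pdivrMr; last 2 first.
      by rewrite natrM mulr_gt0. by rewrite natrM mulr_gt0.
    rewrite -!natrM; apply/andP; split; first by rewrite mulnC; lra.
    have -> : (p.+1 * (5 * n) = 5 * n * p + 5 * n)%N by rewrite mulSn addnC [(p * _)%N]mulnC.
    have : (4 * n)%:R < (5 * n)%:R :> K by rewrite !natrM ltr_pM2r // ltr_nat.
    by rewrite natrD; lra.
  (* The front lies between the rows of [u] and [v], which differ by at most 2. *)
  have l1 : (row u <= level)%N by apply: le_truncn; rewrite es; lra.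
  have l2 : (level <= row v)%N by apply: le_truncn; rewrite es; lra.
  have b3 : (level - row u < 3)%N by clear -h3 h4 l1 l2; lia.
  have p5 : (col v + 2 - col u < 5)%N by clear -h1 h2; lia.
  have q5 : (row v + 2 - row u < 5)%N by clear -h3 h4; lia.
  apply/mapP; exists (Ordinal lu, Ordinal b3, Ordinal p5, Ordinal q5); first by rewrite mem_enum.
  rewrite /= es; clear -h1 h2 h3 h4 l1 l2 mu; congr (_, _, (_, _)); lia.
- (* the key grows by at least 5n - 2 > 2 from one strip to the next *)
  exfalso; have [_] := near_dist uv; rewrite ler_norml => /andP[a1 a2].
  have : (5 * n * q + 5 * n)%:R <= (5 * n * p)%:R :> K by rewrite ler_nat; clear -pq; nia.
  have : 1 <= n%:R :> K by rewrite ler1n -(ltr_nat K).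
  by rewrite natrD natrM => *; lra.
(* Here [v] is in a later strip than [u] but at most two columns further, so it is in the first two
   columns of its strip. *)
- apply/orP; right; have lvr : v \in light r by apply: lb; clear -mu mv lu pq h1 h2; nia.
  have p5 : (col u + 2 - col v < 5)%N by clear -h1 h2; lia.
  have q5 : (row u + 2 - row v < 5)%N by clear -h3 h4; lia.
  apply/allpairsP; exists (v, (Ordinal p5, Ordinal q5)); split; rewrite ?mem_enum //=.
  clear -h1 h2 h3 h4; congr (_, _, _); lia.
Qed.
End Strip.

End Geometry.

(** * Solutions and runs of the scan *)

Section Equivalence.
Variables (K : realType) (n : nat) (c : 'I_n -> K * K) (R : {set 'I_n}) (rho : 'I_n).
Variables (k w S : nat).

(* 526 w slots suffice: the two lists of cell pairs have at most 175 w elements,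
   each contributes at most 3 active vertices, and one slot holds the padding. *)
Definition order r : nat -> 'I_n := unrank (key c rho w S r) rho.

(** Fixed sizes, together with distances and a count below [n], are what a word of fixed length in
    base [n] can code; this lets [acceptedP] be an equivalence. *)
Record scan_run r (P Q : nat -> seq (fact 'I_n)) (m : nat -> nat) : Prop := ScanRun {
  run_size i : (i <= n)%N -> size (P i) = (526 * w)%N /\ size (Q i) = (526 * w)%N;
  run_lt i f : (i <= n)%N -> f \in P i ++ Q i -> (f.2 < n)%N;
  run_spent_lt i : (i <= n)%N -> (m i < n)%N;
  run_start f : f \in P 0%N ++ Q 0%N -> f = (rho, 0%N);
  run_spent0 : m 0%N = 0%N;
  run_end f : f \in Q n -> f = (rho, 0%N);
  run_spent_le : (m n <= k)%N;
  run_step i : (i < n)%N -> scan_step (near c) R n (order r i)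
    (fun f => f \in P i) (fun f => f \in Q i) (m i)
    (fun f => f \in P i.+1) (fun f => f \in Q i.+1) (m i.+1)
}.

Hypotheses (w_gt0 : (0 < w)%N) (S_large : (2 * n + 1 <= S)%N).
Hypotheses (rhoR : rho \in R) (w_large : (#|R| + k <= w * w)%N).

Lemma scan_run_sound r P Q m : scan_run r P Q m -> steiner_yes (disk_graph c) R k.
Proof.
case=> _ _ _ st _ en sk steps.
have [||X [d [RX cX par]]] := @scan_sound _ (near c) R n n rho (order r)
  (fun i f => f \in P i) (fun i f => f \in Q i) m _ en steps rhoR.
- by move=> f h; apply: st; rewrite mem_cat h.
- by move=> v vR; exists (rank (key c rho w S r) v); [exact: rank_lt|exact: rankK].
apply: (@steiner_yes_of_parents _ _ R X rho d); rewrite ?(leq_trans cX) //.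
- exact: disk_graph_sym.
- exact: (fintype.subsetP RX).
move=> v vX vr; have [u [uX uv duv]] := par v vX vr.
exists u; split=> //; rewrite disk_graphE uv andbT.
by apply: contraTneq duv => ->; rewrite ltnn.
Qed.

Lemma scan_run_complete : steiner_yes (disk_graph c) R k ->
  exists2 r, (r < w)%N & exists P Q m, scan_run r P Q m.
Proof.
case=> X [eT [[eTsym eTsub] [_ conn _] RX cX]].
have rhoX : rho \in X by exact: (fintype.subsetP RX).
have Xc : {in X, forall v, connect (near_in c X) rho v}.
  move=> v vX; apply: connect_sub (conn _ _ rhoX vX) => a b /eTsub /and3P[aX bX].
  by rewrite disk_graphE => /andP[_ ab]; apply: connect1; rewrite /near_in aX bX.
have Xw : (#|X| <= w * w)%N.
  apply: leq_trans w_large; rewrite -(cardsID R X) leq_add // subset_leq_card //.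
  exact: finset.subsetIr.
have [r rw lw] := light_shift c rho w_gt0 Xw.
set kf := key c rho w S r; set rk := rank kf.
pose cell v := (col c rho v, row c rho v).
pose H := sparse (near c) X cell rk.
have clique : {in X &, forall u v, cell u = cell v -> near c u v}.
  by move=> u v uX vX; exact: cell_near rhoX Xc _ _ uX vX.
have Hs : symmetric H by exact: sparse_sym.
have Ha u v : H u v -> near c u v by apply: sparse_adj => //; exact: near_sym.
have Hc v : v \in X -> connect H rho v.
  move=> vX; apply: connect_sub (Xc v vX) => a b /and3P[aX bX ab].
  by apply: connect_sparse => //; exact: rank_inj.
have HX u v : H u v -> u \in X by case/and3P.
have act i : (i <= n)%N -> (#|rho |: active H X rk i| <= 526 * w)%N.
  move=> iN; have ->: (526 * w = w + 525 * w)%N by lia.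
  apply: leq_trans (leq_card_setU _ _) _; rewrite cards1; apply: leq_add => //.
  (* At [i = n] nothing is left to scan, and no vertex supplies the key of a front. *)
  move: iN; rewrite leq_eqVlt => /orP[/eqP->|iN].
    rewrite (_ : active _ _ _ _ = finset.set0) ?cards0 //.
    apply/setP => u; rewrite !finset.inE; apply/negbTE/negP => /and3P[_ _ /existsP[v]].
    by rewrite leqNgt rank_lt andbF.
  pose k0 := kf (order r i).
  have hT u v : u \in X -> v \in X -> near c u v -> (rk u < i)%N -> (i <= rk v)%N ->
      (cell u, cell v) \in near_strip c rho w r k0 ++ near_light c rho X w r.
    move=> uX vX uv ui iv; apply: (front_cells rhoX Xc w_gt0 S_large) => //.
      by apply: rank_key; rewrite -/kf unrankK // ltnW.
    by apply: rank_key; rewrite -/kf unrankK.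
  apply: leq_trans (card_active (near_sym c) (@rank_inj _ _ _) clique hT) _.
  by rewrite size_near; lia.
pose d := bfs H rho.
have par v : v \in X -> v != rho -> exists u, [/\ u \in X, H u v & (d u).+1 = d v].
  move=> vX vr; have [u [_ uv du]] := bfs_parent (Hc v vX) vr.
  by exists u; split=> //; exact: HX uv.
have dlt v : v \in X -> (d v < n)%N.
  by move=> vX; rewrite -[X in (_ < X)%N]card_ord; have [] := bfsP (Hc v vX).
have d0 : d rho = 0%N by exact: bfs_root.
pose pad (A : {set 'I_n}) : seq (fact 'I_n) :=
  let s := [seq (u, d u) | u <- enum (rho |: A)] in s ++ nseq (526 * w - size s) (rho, 0%N).
have padP A f : f \in pad A <-> facts_of rho d A f.
  rewrite /pad mem_cat mem_nseq; split.
    case/orP=> [/mapP[u]|/andP[_ /eqP->]]; last by split; rewrite ?finset.setU11.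
    by rewrite mem_enum => uA ->.
  case: f => u du [/= uA ->]; apply/orP; left; apply/mapP; exists u => //.
  by rewrite mem_enum.
have pad_size A : (#|rho |: A| <= 526 * w)%N -> size (pad A) = (526 * w)%N.
  by move=> hA; rewrite size_cat size_nseq size_map -cardE subnKC.
have dem i : demands H X rho rk d i \subset active H X rk i by exact: demands_active.
have padlt (A : {set 'I_n}) f : A \subset X -> f \in pad A -> (f.2 < n)%N.
  move=> AX /padP[fA ->]; apply: dlt; move: fA; rewrite finset.in_setU1.
  by case/orP=> [/eqP->//|]; exact: (fintype.subsetP AX).
have actX i : active H X rk i \subset X.
  by apply/fintype.subsetP => u; rewrite finset.inE => /andP[].
exists r => //; exists (fun i => pad (active H X rk i)), (fun i => pad (demands H X rho rk d i)),
  (spent R X rk); split.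
- move=> i iN; rewrite !pad_size ?act //; apply: leq_trans (act i iN).
  exact/subset_leq_card/finset.setUS.
- move=> i f iN; rewrite mem_cat => /orP[]; apply: padlt => //.
  exact: fintype.subset_trans (dem i) (actX i).
(* The terminal [rho] is never counted, which keeps the count of Steiner vertices below [n], hence a
   single digit. *)
- move=> i iN; apply: (@leq_ltn_trans #|X :\ rho|).
    apply/subset_leq_card/fintype.subsetP => u; rewrite !finset.inE.
    by case/and3P=> -> uR _; rewrite andbT; apply: contraNneq uR => ->.
  rewrite -[X in (_ < X)%N](card_ord n) -cardsT; apply: proper_card.
  by apply/properP; split; [exact: finset.subsetT|exists rho; rewrite !finset.inE ?eqxx].
- move=> f; rewrite mem_cat => /orP[] /padP.
    exact: facts_of_start.
  case: f => u du [/= + ->]; rewrite finset.in_setU1 => /orP[/eqP->|]; first by rewrite d0.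
  by move/(fintype.subsetP (dem 0%N)); rewrite finset.inE ltn0 andbF.
- exact: spent0.
- by move=> f /padP; apply: facts_of_end => //; exact: rank_lt.
- by rewrite spent_end //; exact: rank_lt.
move=> i iN.
have rkK v : order r (rank kf v) = v by exact: rankK.
have [st|[D Dn st]] := scan_complete RX rkK (@unrankK _ _ kf rho) Ha dlt par iN;
  [left|right; exists D => //].
- case: st => h1 h2 h3 h4; split=> // f /padP h; apply/padP; auto.
- case: st => h1 h2 h3 h4; split=> //.
  + by move=> f /padP /h1[/padP|]; [left|right].
  + by move=> f /padP /h2[/padP|]; [left|right].
  + by case: h3 => [/padP|[f /padP ? ?]]; [left|right; exists f].
Qed.
End Equivalence.

(** * The program *)

Section Program.
Local Open Scope nat_scope.

Local Notation "a ;; b" := (CSeq a b) (at level 90, right associativity).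
Local Notation "$ a" := (ncell a) (at level 2, a at level 1, format "$ a").
Local Notation "# x" := (NCst x) (at level 2, x at level 1, format "# x").
Local Notation "a :[ i ]" := (NCell a i) (at level 2, i at level 80, format "a :[ i ]").
Local Notation "a <~ e" := (CN a (NCst 0) e) (at level 85).
Local Infix "+:" := NAdd (at level 50, left associativity).
Local Infix "<=:" := NLe (at level 70).
Local Notation "a =: b" := (FAnd (FA (NLe a b)) (FA (NLe b a))) (at level 70).
Local Notation "f '/\:' g" := (FAnd f g) (at level 75, right associativity).
Local Notation "f '\/:' g" := (FOr f g) (at level 77, right associativity).

(* Integer arrays; those used as scalars have their value in cell 0. *)
Local Notation aR := 1 (only parsing).
Local Notation vn := 2 (only parsing).
Local Notation vN := 3 (only parsing).
Local Notation vw := 4 (only parsing).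
Local Notation vsq := 5 (only parsing).
Local Notation vB := 6 (only parsing).
Local Notation vL := 7 (only parsing).
Local Notation vS := 8 (only parsing).
Local Notation vacc := 9 (only parsing).
Local Notation vrho := 10 (only parsing).
Local Notation vfound := 11 (only parsing).
Local Notation vq := 12 (only parsing).
Local Notation vrem := 13 (only parsing).
Local Notation aquo := 14 (only parsing).
Local Notation arem := 15 (only parsing).
Local Notation vx := 16 (only parsing).
Local Notation aoff := 17 (only parsing).
Local Notation adig := 18 (only parsing).
Local Notation vo := 19 (only parsing).
Local Notation vans := 20 (only parsing).
Local Notation aord := 21 (only parsing).
Local Notation vcnt := 22 (only parsing).
Local Notation amark := 23 (only parsing).
Local Notation vm := 24 (only parsing).
Local Notation vv := 25 (only parsing).
Local Notation vr := 26 (only parsing).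
Local Notation vi := 27 (only parsing).
Local Notation vc1 := 28 (only parsing).
Local Notation vc2 := 29 (only parsing).
Local Notation vj := 30 (only parsing).
Local Notation vj' := 31 (only parsing).
Local Notation vd := 32 (only parsing).
Local Notation vflag := 33 (only parsing).
Local Notation vu := 34 (only parsing).
Local Notation vl := 35 (only parsing).

(* A state is coded by its digits in base n: the vertices of its B facts in P,
   their distances, the same for Q, and the number of Steiner vertices. *)
Definition digit (c j : nexp) : nexp := adig:[aoff:[c] +: j].
Definition Bx2 : nexp := $vB +: $vB.
Definition Bx3 : nexp := $vB +: $vB +: $vB.
Definition Bx4 : nexp := $vB +: $vB +: $vB +: $vB.

Definition nearR (u v : nexp) : test :=
  let dx := RSub (RCell 0 u) (RCell 0 v) in let dy := RSub (RCell 1 u) (RCell 1 v) in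
  RLe (RAdd (RMul dx dx) (RMul dy dy)) (RCst 4).

Definition mem_fml (c b1 b2 u d : nexp) : fml :=
  FEx vj' vB ((digit c (b1 +: $vj') =: u) /\: (digit c (b2 +: $vj') =: d)).

Definition skip_fml : fml :=
  FA (aR:[$vv] <=: #0)
  /\: (digit $vc2 Bx4 =: digit $vc1 Bx4)
  /\: FAll vj vB (mem_fml $vc1 #0 $vB (digit $vc2 (#0 +: $vj)) (digit $vc2 ($vB +: $vj)))
  /\: FAll vj vB (mem_fml $vc2 Bx2 Bx3 (digit $vc1 (Bx2 +: $vj)) (digit $vc1 (Bx3 +: $vj))).

(** The equation [m' + [v in R] = m + 1] expresses [m' = m + [v notin R]] directly with the
    indicator array of [R]. *)
Definition take_fml : fml :=
  (digit $vc2 Bx4 +: aR:[$vv] =: digit $vc1 Bx4 +: #1)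
  /\: FEx vd vn
    (FAll vj vB (mem_fml $vc1 #0 $vB (digit $vc2 (#0 +: $vj)) (digit $vc2 ($vB +: $vj))
       \/: (digit $vc2 (#0 +: $vj) =: $vv) /\: (digit $vc2 ($vB +: $vj) =: $vd))
    /\: FAll vj vB (mem_fml $vc2 Bx2 Bx3 (digit $vc1 (Bx2 +: $vj)) (digit $vc1 (Bx3 +: $vj))
       \/: (digit $vc1 (Bx3 +: $vj) =: $vd +: #1) /\: FA (nearR $vv (digit $vc1 (Bx2 +: $vj))))
    /\: (mem_fml $vc2 Bx2 Bx3 $vv $vd
       \/: FEx vj vB ((digit $vc1 ($vB +: $vj) +: #1 =: $vd)
            /\: FA (nearR (digit $vc1 (#0 +: $vj)) $vv)))).

Definition trans_fml : fml :=
  FEx vc1 vS (FA (#1 <=: amark:[$vm +: $vc1]) /\: (skip_fml \/: take_fml)).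

Definition init_fml : fml :=
  FAll vj vB ((digit $vc2 (#0 +: $vj) =: $vrho) /\: (digit $vc2 ($vB +: $vj) =: #0))
  /\: FAll vj vB ((digit $vc2 (Bx2 +: $vj) =: $vrho) /\: (digit $vc2 (Bx3 +: $vj) =: #0))
  /\: (digit $vc2 Bx4 =: #0).

Definition final_fml : fml :=
  FEx vc1 vS (FA (#1 <=: amark:[$vm +: $vc1])
  /\: FAll vj vB ((digit $vc1 (Bx2 +: $vj) =: $vrho) /\: (digit $vc1 (Bx3 +: $vj) =: #0))
  /\: FA (digit $vc1 Bx4 <=: 0:[#2])).

Definition find_root : cmd :=
  CFor vv vn (CIf (#1 <=: aR:[$vv]) (vrho <~ $vv ;; vfound <~ #1) CSkip).

Definition find_width : cmd :=
  CFor vl vN (CIf ($vN <=: $vsq) CSkip (vsq <~ $vsq +: $vw +: $vw +: #1 ;; vw <~ $vw +: #1)).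

Definition find_slots (slots : nat) : cmd :=
  CFor vl vw (vB <~ $vB +: #slots) ;; vL <~ Bx4 +: #1 ;; vS <~ #1.

Definition mul_S : cmd := CFor vl vn (vacc <~ $vacc +: $vS).
Definition find_codes : cmd := CFor vj vL (vacc <~ #0 ;; mul_S ;; vS <~ $vacc).

(** Division by [n] of all codes at once: quotient and remainder are updated by counting from one
    code to the next. *)
Definition quotients : cmd :=
  CFor vl vS (CN aquo $vl $vq ;; CN arem $vl $vrem ;;
    CIf ($vn <=: $vrem +: #1) (vq <~ $vq +: #1 ;; vrem <~ #0) (vrem <~ $vrem +: #1)).

Definition digits_of : cmd :=
  CFor vj vL (CN adig $vo (arem:[$vx]) ;; vx <~ aquo:[$vx] ;; vo <~ $vo +: #1).

(** The offset of each code is stored as a running sum, in place of the product of the code and the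
    number of digits. *)
Definition digits : cmd :=
  CFor vc1 vS (vx <~ $vc1 ;; CN aoff $vc1 $vo ;; digits_of).

Local Notation rset a e := (CR a (NCst 0) e).
Local Notation rcell a := (RCell a (NCst 0)).

(* Real array 2 holds the keys; cells 0 of arrays 3, 4, 5 and 6 hold 2w,
   2n + 2r - x_rho, 5n and the next strip boundary. *)
Definition reals : cmd :=
  rset 4 (RSub (RCst 0) (RCell 0 $vrho)) ;;
  CFor vl vn (rset 4 (RAdd (rcell 4) (RCst 2)) ;; rset 5 (RAdd (rcell 5) (RCst 5))) ;;
  CFor vl vw (rset 3 (RAdd (rcell 3) (RCst 2))).

Definition key_of : cmd :=
  CFor vl vS (CIf (RLe (rcell 6) (RAdd (RCell 0 $vv) (rcell 4)))
      (CR 2 $vv (RAdd (RCell 2 $vv) (rcell 5))) CSkip ;;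
    rset 6 (RAdd (rcell 6) (rcell 3))).

Definition keys : cmd :=
  CFor vv vn (CR 2 $vv (RCell 1 $vv) ;; rset 6 (rcell 3) ;; key_of).

Definition rank_of : cmd :=
  CFor vu vn (CIf ($vu +: #1 <=: $vv)
    (CIf (RLe (RCell 2 $vu) (RCell 2 $vv)) (vcnt <~ $vcnt +: #1) CSkip)
    (CIf (RLe (RCell 2 $vv) (RCell 2 $vu)) CSkip (vcnt <~ $vcnt +: #1))).

Definition ranks : cmd :=
  CFor vv vn (vcnt <~ #0 ;; rank_of ;; CN aord $vcnt $vv).

Definition init_layer : cmd :=
  CFor vc2 vS (chk vflag init_fml ;; CN amark $vc2 $vflag).

(* Marks of layer i start at index i S of the array; m is that index. *)
Definition next_layer : cmd :=
  CFor vc2 vS (chk vflag trans_fml ;; CN amark ($vm +: $vS +: $vc2) $vflag).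

Definition layers : cmd :=
  vm <~ #0 ;; CFor vi vn (vv <~ aord:[$vi] ;; next_layer ;; vm <~ $vm +: $vS).

Definition final_check : cmd :=
  chk vflag final_fml ;; CIf (#1 <=: $vflag) (vans <~ #1) CSkip.

Definition scan_shift : cmd :=
  keys ;; ranks ;; init_layer ;; layers ;; final_check ;; rset 4 (RAdd (rcell 4) (RCst 2)).

Definition scan_all : cmd :=
  quotients ;; digits ;; reals ;; CFor vr vw scan_shift ;; 0 <~ $vans.

(** For [n <= 1] the input already is the answer: the output cell holds [n], and the instance is a
    yes-instance exactly when [n = 1]. Without terminals, one vertex is a tree within the budget.
    The parts are compiled one by one because [exec_comp] asks that a command never assign the
    bounds of its loops, whereas [vw], [vB], [vL] and [vS] are computed in one part to bound loops
    of later ones. *)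
Definition steiner_prog (slots : nat) : prog :=
  If (0:[#0] <=: #1) Skip
  (Seq (comp (vn <~ 0:[#0] ;; vN <~ 0:[#1] +: 0:[#2]))
  (Seq (comp find_root)
  (If ($vfound <=: #0) (comp (0 <~ #1))
  (Seq (comp find_width)
  (Seq (comp (find_slots slots))
  (Seq (comp find_codes) (comp scan_all))))))).

Lemma wff_init : wff vflag init_fml. Proof. by []. Qed.
Lemma wff_trans : wff vflag trans_fml. Proof. by []. Qed.
Lemma wff_final : wff vflag final_fml. Proof. by []. Qed.

Lemma bounded_scan : bounded_by [:: vn; vw; vB; vL; vS] scan_all.
Proof. by []. Qed.

(** * Tables of digits and real constants *)

Variable K : realType.
Implicit Types s : state K.

Lemma den_seq c1 c2 s : den (c1 ;; c2) s = den c2 (den c1 s).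
Proof. by []. Qed.

Lemma quotientsP s n : 0 < n -> nmem s vn 0 = n -> nmem s vq 0 = 0 -> nmem s vrem 0 = 0 ->
  forall x, x < nmem s vS 0 ->
  nmem (den quotients s) aquo x = x %/ n /\ nmem (den quotients s) arem x = x %% n.
Proof.
move=> n0 sn q0 r0.
pose Inv i s' := [/\ nmem s' vq 0 = i %/ n, nmem s' vrem 0 = i %% n &
  forall x, x < i -> nmem s' aquo x = x %/ n /\ nmem s' arem x = x %% n].
suff [] : Inv (nmem s vS 0) (den quotients s) by [].
apply: for_ind => //.
  by split; rewrite //= /upd /= ?q0 ?r0 ?div0n ?mod0n.
move=> i s' iS hx fr _ [hq hr ht]; have hn : nmem s' vn 0 = n by rewrite fr.
have lt := ltn_mod i n; rewrite n0 in lt.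
have div_mod : (i.+1 %/ n = if n <= i %% n + 1 then i %/ n + 1 else i %/ n)
    /\ (i.+1 %% n = if n <= i %% n + 1 then 0 else i %% n + 1).
  have e : i.+1 = i %/ n * n + (i %% n + 1) by rewrite addn1 addnS -divn_eq.
  case: ifP => h; rewrite e.
    have -> : i %% n + 1 = n by apply/eqP; rewrite eqn_leq h addn1 lt.
    by rewrite divnMDl // modnMDl divnn n0 modnn.
  have {}h : i %% n + 1 < n by rewrite ltnNge h.
  by rewrite divnMDl // modnMDl (divn_small h) (modn_small h) addn0.
case: div_mod => ed em; rewrite /Inv ed em /incr /= /upd /= hn hq hr hx.
case: ifP => h /=; rewrite /upd /= ?hq ?hr; split=> // x;
  rewrite ltnS leq_eqVlt; case: eqP => [->|_] //=; exact: ht.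
Qed.

Lemma digits_ofP s n c o : 0 < n -> nmem s vx 0 = c -> nmem s vo 0 = o ->
  (forall x, x <= c -> nmem s aquo x = x %/ n /\ nmem s arem x = x %% n) ->
  let s' := den digits_of s in
  [/\ nmem s' vo 0 = o + nmem s vL 0,
    forall j, j < nmem s vL 0 -> nmem s' adig (o + j) = c %/ n ^ j %% n &
    forall x, x < o -> nmem s' adig x = nmem s adig x].
Proof.
move=> n0 hx ho htab.
pose Inv i s' := [/\ nmem s' vx 0 = c %/ n ^ i, nmem s' vo 0 = o + i,
    forall j, j < i -> nmem s' adig (o + j) = c %/ n ^ j %% n &
    forall x, x < o -> nmem s' adig x = nmem s adig x].
suff [] : Inv (nmem s vL 0) (den digits_of s) by [].
apply: for_ind => //.
  by split; rewrite //= /upd /= ?hx ?ho ?expn0 ?divn1 ?addn0.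
move=> i s' iL _ fr _ [hx' ho' hd hlt].
have [hq hr] := htab _ (leq_div c (n ^ i)).
have eq : nmem s' aquo = nmem s aquo by rewrite fr.
have er : nmem s' arem = nmem s arem by rewrite fr.
rewrite /Inv /incr /= /upd /= ?hx' ?ho' !eq !er hq hr; split.
- by rewrite expnSr divnMA.
- by rewrite addn1 addnS.
- move=> j; rewrite ltnS leq_eqVlt; case: eqP => [->|ji] /=; first by rewrite eqxx.
  by rewrite eqn_add2l (negbTE (introN eqP ji)) => /hd.
- by move=> x xo; rewrite hlt // -[X in x == X]addn0; case: eqP => // e; move: xo; rewrite e; lia.
Qed.

Lemma digitsP s n : 0 < n -> nmem s vo 0 = 0 ->
  (forall x, x < nmem s vS 0 -> nmem s aquo x = x %/ n /\ nmem s arem x = x %% n) ->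
  let s' := den digits s in
  forall c j, c < nmem s vS 0 -> j < nmem s vL 0 ->
  nmem s' adig (nmem s' aoff c + j) = c %/ n ^ j %% n.
Proof.
move=> n0 ho htab; set L := nmem s vL 0.
pose Inv i s' := [/\ nmem s' vo 0 = i * L,
  forall c, c < i -> nmem s' aoff c = c * L &
  forall c j, c < i -> j < L -> nmem s' adig (c * L + j) = c %/ n ^ j %% n].
suff [_ h1 h2] : Inv (nmem s vS 0) (den digits s).
  by move=> s' c j cS jL; rewrite h1 // h2.
apply: for_ind => //.
move=> i s' iS hx fr _ [ho' hoff hdig].
set s1 := den (vx <~ $vc1 ;; CN aoff $vc1 $vo) s'.
have [|||e1 e2 e3] := @digits_ofP s1 n i (i * L) n0.
- by rewrite /s1 /= /upd /= hx.
- by rewrite /s1 /= /upd /= ho'.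
- move=> x xi; have -> : nmem s1 aquo = nmem s aquo by rewrite /s1 nmem_den // fr.
  have -> : nmem s1 arem = nmem s arem by rewrite /s1 nmem_den // fr.
  by apply: htab; exact: leq_ltn_trans iS.
have eL : nmem s1 vL 0 = L by rewrite /s1 nmem_den // fr.
rewrite eL in e1 e2.
have eoff : nmem (den digits_of s1) aoff = nmem s1 aoff by rewrite nmem_den.
have -> : den (vx <~ $vc1 ;; CN aoff $vc1 $vo ;; digits_of) s' = den digits_of s1 by [].
split.
- by rewrite /incr [LHS]/= upd_neq // e1 mulSn addnC.
- move=> c; rewrite /incr [nmem _ _]/= upd_neq // eoff /s1 /= /upd /= hx ho'.
  by rewrite ltnS leq_eqVlt; case: eqP => [->|_] //=; exact: hoff.
- move=> c j; rewrite /incr [nmem _ _]/= upd_neq // ltnS leq_eqVlt => /orP[/eqP->|ci] jL.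
    exact: e2.
  rewrite e3; last by apply: (@leq_trans (c.+1 * L)); rewrite ?leq_mul2r ?ci ?orbT // mulSn; lia.
  by rewrite /s1 /= /upd /= hdig.
Qed.

Lemma realsP s n w rho : nmem s vn 0 = n -> nmem s vw 0 = w -> nmem s vrho 0 = rho ->
  rmem s 3 0 = 0%R -> rmem s 5 0 = 0%R ->
  let s' := den reals s in
  [/\ rmem s' 4 0 = (- rmem s 0 rho + (2 * n)%:R)%R, rmem s' 5 0 = ((5 * n)%:R)%R
    & rmem s' 3 0 = ((2 * w)%:R)%R].
Proof.
move=> hn hw hrho h3 h5.
set c1 := rset 4 (RSub (RCst 0) (RCell 0 $vrho)).
set c2 := CFor vl vn (rset 4 (RAdd (rcell 4) (RCst 2)) ;; rset 5 (RAdd (rcell 5) (RCst 5))).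
set c3 := CFor vl vw (rset 3 (RAdd (rcell 3) (RCst 2))).
have -> : den reals s = den c3 (den c2 (den c1 s)) by [].
set s1 := den c1 s; set s2 := den c2 s1.
have [e4 e5] : rmem s2 4 0 = (- rmem s 0 rho + (2 * n)%:R)%R /\ rmem s2 5 0 = ((5 * n)%:R)%R.
  pose Inv i s' := rmem s' 4 0 = (- rmem s 0 rho + (2 * i)%:R)%R /\ rmem s' 5 0 = ((5 * i)%:R)%R.
  have hn1 : nmem s1 vn 0 = n by [].
  suff : Inv (nmem s1 vn 0) s2 by rewrite hn1.
  apply: for_ind => //.
    by rewrite /Inv /= /upd /= hrho h5 GRing.sub0r GRing.addr0.
  move=> i s' _ _ _ _ [h4' h5']; rewrite /Inv /incr /= /upd /= h4' h5' !mulnS !natrD.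
  by split; ring.
have e3 : rmem (den c3 s2) 3 0 = ((2 * w)%:R)%R.
  pose Inv i s' := rmem s' 3 0 = ((2 * i)%:R)%R.
  have hw1 : nmem s2 vw 0 = w by rewrite /s2 nmem_den.
  suff : Inv (nmem s2 vw 0) (den c3 s2) by rewrite hw1.
  apply: for_ind => //.
    by rewrite /Inv /= rmem_den //= /upd.
  move=> i s' _ _ _ _ h3'; rewrite /Inv /incr /= /upd /= h3' mulnS natrD.
  by ring.
by split; rewrite // rmem_den.
Qed.

(** * One shift: keys, order and layers of reachable states *)

Section Layers.
Variables (n : nat) (c : 'I_n -> K * K) (rho : 'I_n) (w S : nat).

Record coords s : Prop := Coords {
  coord_x (v : 'I_n) : rmem s 0 v = (c v).1;
  coord_y (v : 'I_n) : rmem s 1 v = (c v).2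
}.

Lemma key_ofP s r (v : 'I_n) : coords s -> nmem s vv 0 = v -> nmem s vS 0 = S ->
  rmem s 4 0 = (- (c rho).1 + (2 * n + 2 * r)%:R)%R ->
  rmem s 5 0 = ((5 * n)%:R)%R -> rmem s 3 0 = ((2 * w)%:R)%R ->
  rmem s 6 0 = ((2 * w)%:R)%R -> rmem s 2 v = (c v).2 ->
  rmem (den key_of s) 2 v = key c rho w S r v /\
  forall u, u != v :> nat -> rmem (den key_of s) 2 u = rmem s 2 u.
Proof.
move=> [hx hy] hv hS h4 h5 h3 h6 h2.
pose p i := ((2 * w * i.+1)%:R <= (c v).1 - (c rho).1 + (2 * n + 2 * r)%:R)%R.
pose Inv i s' := [/\ rmem s' 6 0 = ((2 * w * i.+1)%:R)%R,
  rmem s' 2 v = ((c v).2 + (5 * n * count p (iota 0 i))%:R)%R &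
  forall u, u != v :> nat -> rmem s' 2 u = rmem s 2 u].
suff [_ h h'] : Inv (nmem s vS 0) (den key_of s) by rewrite -hS.
apply: for_ind => //.
  by split; rewrite //= ?h6 ?muln1 ?h2 ?muln0 ?GRing.addr0.
move=> i s' _ _ fr hrm [h6' h2' hu].
have [e0 e3 e4 e5] : [/\ rmem s' 0 = rmem s 0, rmem s' 3 = rmem s 3, rmem s' 4 = rmem s 4
  & rmem s' 5 = rmem s 5] by split; rewrite hrm.
have ev : nmem s' vv 0 = v by rewrite fr.
have pE : teval s' (RLe (rcell 6) (RAdd (RCell 0 $vv) (rcell 4))) = p i.
  by rewrite /= ev e0 e4 h6' hx h4 /p GRing.addrA.
have ci : count p (iota 0 i.+1) = count p (iota 0 i) + p i.
  by rewrite -[i.+1]addn1 iotaD count_cat /= add0n addn0.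
set A := CR 2 _ _; set D := rset 6 _.
have -> : den (CIf (RLe (rcell 6) (RAdd (RCell 0 $vv) (rcell 4))) A CSkip ;; D) s' =
    den D (if p i then den A s' else s') by rewrite -pE.
rewrite /Inv ci /incr; case: (p i); rewrite /= /upd /= ?ev ?e3 ?e5 h6' ?h2' h3.
- split.
  + by rewrite [in RHS]mulnS natrD GRing.addrC.
  + by rewrite eqxx h5 mulnDr muln1 natrD GRing.addrA.
  + by move=> u uv; rewrite (negbTE uv) hu.
- split=> //; last by rewrite addn0.
  by rewrite [in RHS]mulnS natrD GRing.addrC.
Qed.

Lemma keysP s r : coords s -> nmem s vn 0 = n -> nmem s vS 0 = S ->
  rmem s 4 0 = (- (c rho).1 + (2 * n + 2 * r)%:R)%R ->
  rmem s 5 0 = ((5 * n)%:R)%R -> rmem s 3 0 = ((2 * w)%:R)%R ->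
  forall v : 'I_n, rmem (den keys s) 2 v = key c rho w S r v.
Proof.
move=> [hx hy] hn hS h4 h5 h3.
pose Inv i s' := forall v : 'I_n, v < i -> rmem s' 2 v = key c rho w S r v.
suff h : Inv (nmem s vn 0) (den keys s) by move=> v; apply: h; rewrite hn.
apply: for_ind => //.
move=> i s' ib hi fr hrm hI; rewrite hn in ib; pose v := Ordinal ib.
set s1 := den (CR 2 $vv (RCell 1 $vv) ;; rset 6 (rcell 3)) s'.
have f0 a : a \notin [:: 2; 6] -> rmem s1 a = rmem s a.
  move=> ha; rewrite /s1 rmem_den // hrm //.
  by move: ha; rewrite /= !inE !negb_or => /andP[-> ->].
have n1 a : a \notin nmods keys -> nmem s1 a = nmem s a by move=> ha; rewrite /s1 nmem_den // fr.
have [||||||||e1 e2] := @key_ofP s1 r v.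
- by split=> u; rewrite f0.
- by rewrite /s1 /=.
- by rewrite n1.
- by rewrite f0.
- by rewrite f0.
- by rewrite f0.
- by rewrite /s1 /= /upd /= hrm.
- by rewrite /s1 /= /upd /= hi eqxx hrm //; exact: hy v.
have -> : den (CR 2 $vv (RCell 1 $vv) ;; rset 6 (rcell 3) ;; key_of) s' = den key_of s1 by [].
move=> u; rewrite ltnS leq_eqVlt /incr [rmem _ _]/=; case: eqP => [ui _|ui /= ui'].
  have -> : u = v by apply: val_inj; exact: ui.
  exact: e1.
rewrite e2; last exact/eqP.
by rewrite /s1 /= /upd /= hi (negbTE (introN eqP ui)) hI.
Qed.

Lemma rank_ofP s (kf : 'I_n -> K) (v : 'I_n) : nmem s vn 0 = n ->
  nmem s vv 0 = v -> nmem s vcnt 0 = 0 -> (forall u : 'I_n, rmem s 2 u = kf u) ->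
  nmem (den rank_of s) vcnt 0 = rank kf v.
Proof.
move=> hn hv h0 hk.
pose A i := [set u : 'I_n | (u < i) && before kf u v].
pose Inv i s' := nmem s' vcnt 0 = #|A i|.
have -> : rank kf v = #|A n|.
  by apply: eq_card => u; rewrite !finset.inE ltn_ord.
suff : Inv (nmem s vn 0) (den rank_of s) by rewrite hn.
apply: for_ind => //.
  rewrite /Inv /= /upd /= h0; apply/esym/eqP; rewrite cards_eq0; apply/eqP/setP => u.
  by rewrite !finset.inE.
move=> i s' ib hi fr hrm hI; rewrite hn in ib; pose u := Ordinal ib.
have ek : rmem s' 2 = rmem s 2 by rewrite hrm.
have ev : nmem s' vv 0 = v by rewrite fr.
have cA : #|A i.+1| = #|A i| + before kf u v.
  rewrite (cardsD1 u) addnC finset.inE ltnSn; congr (_ + _); apply: eq_card => x.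
  rewrite !finset.inE ltnS leq_eqVlt -(inj_eq val_inj) /=.
  by case: eqP => //= ->; rewrite ltnn.
have hu : rmem s 2 i = kf u by exact: hk u.
rewrite /Inv cA /before /incr /= hi ev addn1 ek hk hu.
by case: ltnP => _; rewrite ?[(_ < _)%R]ltNge; case: (_ <= _)%R;
  rewrite /= /upd /= hI ?addn0.
Qed.

Lemma ranksP s (kf : 'I_n -> K) : nmem s vn 0 = n ->
  (forall u : 'I_n, rmem s 2 u = kf u) ->
  forall v : 'I_n, nmem (den ranks s) aord (rank kf v) = v.
Proof.
move=> hn hk.
pose Inv i s' := forall v : 'I_n, v < i -> nmem s' aord (rank kf v) = v.
suff h : Inv (nmem s vn 0) (den ranks s) by move=> v; apply: h; rewrite hn.
apply: for_ind => //.
move=> i s' ib hi fr hrm hI; rewrite hn in ib; pose v := Ordinal ib.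
set s1 := den (vcnt <~ #0) s'.
have hr : nmem (den rank_of s1) vcnt 0 = rank kf v.
  apply: rank_ofP => [|||u].
  - by rewrite nmem_den // fr.
  - by rewrite nmem_den.
  - by [].
  - by rewrite /= hrm.
have ho : nmem (den rank_of s1) aord = nmem s' aord by rewrite nmem_den.
have hvv : nmem (den rank_of s1) vv = nmem s' vv by rewrite nmem_den.
have -> : den (vcnt <~ #0 ;; rank_of ;; CN aord $vcnt $vv) s' =
  den (CN aord $vcnt $vv) (den rank_of s1) by [].
move=> u; rewrite ltnS leq_eqVlt /incr; move: (den rank_of s1) hr ho hvv => s2 hr ho hvv.
rewrite /= /upd /= hr hvv hi ho; case: (eqVneq (u : nat) i) => [ui _|ui /= ui'].
  by have -> : u = v by [apply: val_inj; exact: ui]; rewrite eqxx.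
case: eqP => [/rank_inj uv|_]; last exact: hI.
by rewrite uv eqxx in ui.
Qed.

Definition table s (x j : nat) : nat := nmem s adig (nmem s aoff x + j).
(** The test [=:] consists of two comparisons; the predicates below keep that form, so that the
    formulas evaluate to them by computation. *)
Definition eqb2 (a b : nat) : bool := (a <= b) && (b <= a).

Section Transition.
Variables (B : nat) (T : nat -> nat -> nat) (isR : nat -> nat) (nr : nat -> nat -> bool).

Definition has_fact x b1 b2 u d : bool :=
  has (fun j => eqb2 (T x (b1 + j)) u && eqb2 (T x (b2 + j)) d) (iota 0 B).

Definition skip_code v x y : bool :=
  [&& isR v <= 0, eqb2 (T y (B + B + B + B)) (T x (B + B + B + B)),
    all (fun j => has_fact x 0 B (T y (0 + j)) (T y (B + j))) (iota 0 B) &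
    all (fun j => has_fact y (B + B) (B + B + B) (T x (B + B + j)) (T x (B + B + B + j))) (iota 0 B)].

Definition take_code v x y : bool :=
  eqb2 (T y (B + B + B + B) + isR v) (T x (B + B + B + B) + 1) &&
  has (fun d => [&&
    all (fun j => has_fact x 0 B (T y (0 + j)) (T y (B + j)) ||
      eqb2 (T y (0 + j)) v && eqb2 (T y (B + j)) d) (iota 0 B),
    all (fun j => has_fact y (B + B) (B + B + B) (T x (B + B + j)) (T x (B + B + B + j)) ||
      eqb2 (T x (B + B + B + j)) (d + 1) && nr v (T x (B + B + j))) (iota 0 B) &
    has_fact y (B + B) (B + B + B) v d ||
      has (fun j => eqb2 (T x (B + j) + 1) d && nr (T x (0 + j)) v) (iota 0 B)]) (iota 0 n).

Definition init_code rho x : bool :=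
  [&& all (fun j => eqb2 (T x (0 + j)) rho && eqb2 (T x (B + j)) 0) (iota 0 B),
    all (fun j => eqb2 (T x (B + B + j)) rho && eqb2 (T x (B + B + B + j)) 0) (iota 0 B) &
    eqb2 (T x (B + B + B + B)) 0].

Definition final_code rho k x : bool :=
  all (fun j => eqb2 (T x (B + B + j)) rho && eqb2 (T x (B + B + B + j)) 0) (iota 0 B) &&
  (T x (B + B + B + B) <= k).

End Transition.

Definition near_at s (u v : nat) : bool :=
  ((rmem s 0 u - rmem s 0 v) * (rmem s 0 u - rmem s 0 v) +
   (rmem s 1 u - rmem s 1 v) * (rmem s 1 u - rmem s 1 v) <= 4)%R.

Lemma fev_trans s : nmem s vn 0 = n ->
  fev s trans_fml = has (fun x => (1 <= nmem s amark (nmem s vm 0 + x)) &&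
   (skip_code (nmem s vB 0) (table s) (nmem s aR) (nmem s vv 0) x (nmem s vc2 0) ||
    take_code (nmem s vB 0) (table s) (nmem s aR) (near_at s) (nmem s vv 0) x (nmem s vc2 0)))
   (iota 0 (nmem s vS 0)).
Proof. by rewrite /take_code => <-. Qed.

Lemma fev_init s :
  fev s init_fml = init_code (nmem s vB 0) (table s) (nmem s vrho 0) (nmem s vc2 0).
Proof. by []. Qed.

Lemma fev_final s :
  fev s final_fml = has (fun x => (1 <= nmem s amark (nmem s vm 0 + x)) &&
    final_code (nmem s vB 0) (table s) (nmem s vrho 0) (nmem s 0 2) x) (iota 0 (nmem s vS 0)).
Proof. by []. Qed.

Section Reach.
Variables (B k : nat) (T : nat -> nat -> nat) (isR : nat -> nat) (nr : nat -> nat -> bool).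

Fixpoint reach (ordn : nat -> nat) (i y : nat) : bool :=
  if i is i'.+1 then
    has (fun x => reach ordn i' x &&
      (skip_code B T isR (ordn i') x y || take_code B T isR nr (ordn i') x y)) (iota 0 S)
  else init_code B T rho y.

Definition accepted (ordn : nat -> nat) : bool :=
  has (fun x => reach ordn n x && final_code B T rho k x) (iota 0 S).

(** What a shift reads and leaves unchanged, hence finds again after the previous shift. *)
Record ready s : Prop := Ready {
  ready_n : nmem s vn 0 = n;
  ready_B : nmem s vB 0 = B;
  ready_S : nmem s vS 0 = S;
  ready_rho : nmem s vrho 0 = rho;
  ready_k : nmem s 0 2 = k;
  ready_R : nmem s aR = isR;
  ready_T : table s = T;
  ready_near : near_at s = nr;
  ready_coords : coords s
}.

Definition kept : seq nat := [:: vn; vB; vS; vrho; 0; aR; adig; aoff].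

Lemma ready_frame s s' (W W' : seq nat) :
  (forall a, a \notin W -> nmem s' a = nmem s a) ->
  (forall a, a \notin W' -> rmem s' a = rmem s a) ->
  all (fun a => a \notin W) kept -> (0 \notin W') && (1 \notin W') ->
  ready s -> ready s'.
Proof.
move=> hn hr /allP hW /andP[w0 w1].
have fr a : a \in kept -> nmem s' a = nmem s a by move/hW/hn.
have r0 := hr 0 w0; have r1 := hr 1 w1.
move=> [h1 h2 h3 h4 h5 h6 h7 h8 [h9 h10]].
split; rewrite ?fr // -?h7 -?h8.
- by rewrite /table !fr.
- by rewrite /near_at r0 r1.
- by split; rewrite ?r0 ?r1.
Qed.

Lemma ready_den c' s : all (fun a => a \notin nmods c') kept ->
  (0 \notin rmods c') && (1 \notin rmods c') -> ready s -> ready (den c' s).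
Proof.
apply: ready_frame => a; [exact: nmem_den|exact: rmem_den].
Qed.

Lemma ready_setn s a i x : a \notin kept -> ready s -> ready (setn s a i x).
Proof.
move=> ak; apply: (@ready_frame _ _ [:: a] [::]) => //.
- by move=> b; rewrite mem_seq1 => ba; rewrite /= upd_neq.
- by apply/allP => b bk; rewrite mem_seq1; apply: contraNneq ak => <-.
Qed.

Lemma init_layerP s : ready s ->
  forall y, y < S -> nmem (den init_layer s) amark y = init_code B T rho y.
Proof.
move=> rs; pose Inv i s' := forall y, y < i -> nmem s' amark y = init_code B T rho y.
suff : Inv (nmem s vS 0) (den init_layer s) by rewrite (ready_S rs).
apply: for_ind => //.
move=> i s' _ hi fr hrm hI.
have rs' : ready s'.
  by apply: ready_frame fr hrm _ _ rs.
have hf := den_chk s' wff_init; rewrite fev_init hi in hf.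
case: (rs') hf => _ -> _ -> _ _ -> _ _ hf.
have hc : nmem (den (chk vflag init_fml) s') vc2 = nmem s' vc2 by rewrite nmem_den.
have hm : nmem (den (chk vflag init_fml) s') amark = nmem s' amark by rewrite nmem_den.
rewrite den_seq.
move: (den (chk _ _) _) hf hc hm => s2 hf hc hm y.
rewrite /incr /= /upd /= hc hi hm hf ltnS leq_eqVlt.
by case: eqP => [->|_] //=; exact: hI.
Qed.

Lemma next_layerP s m : ready s -> nmem s vm 0 = m ->
  forall y, y < S -> nmem (den next_layer s) amark (m + S + y) =
    has (fun x => (1 <= nmem s amark (m + x)) &&
     (skip_code B T isR (nmem s vv 0) x y || take_code B T isR nr (nmem s vv 0) x y)) (iota 0 S).
Proof.
move=> rs em; pose val y := has (fun x => (1 <= nmem s amark (m + x)) &&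
     (skip_code B T isR (nmem s vv 0) x y || take_code B T isR nr (nmem s vv 0) x y)) (iota 0 S).
(* The current layer lies below index [m + S], so writing the next one leaves it readable. Every
   mark of the next layer is assigned, which also erases those of an earlier shift. *)
pose Inv i s' := (forall y, y < i -> nmem s' amark (m + S + y) = val y) /\
  forall x, x < m + S -> nmem s' amark x = nmem s amark x.
suff [] : Inv (nmem s vS 0) (den next_layer s) by rewrite (ready_S rs).
apply: for_ind => //.
move=> i s' _ hi fr hrm [hI hlt].
have rs' : ready s'.
  by apply: ready_frame fr hrm _ _ rs.
have hf := den_chk s' wff_trans; rewrite fev_trans ?(ready_n rs') // hi in hf.
have em' : nmem s' vm 0 = m by rewrite fr.
have ev : nmem s' vv = nmem s vv by rewrite fr.
have {hf} : nmem (den (chk vflag trans_fml) s') vflag 0 = val i.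
  rewrite hf (ready_S rs') (ready_B rs') (ready_T rs') (ready_R rs') (ready_near rs') em' ev.
  congr nat_of_bool; apply: eq_in_has => x; rewrite mem_iota add0n => /andP[_ xS].
  by rewrite hlt // ltn_add2l.
have hS : nmem (den (chk vflag trans_fml) s') vS 0 = S by rewrite nmem_den // (ready_S rs').
have hm : nmem (den (chk vflag trans_fml) s') vm 0 = m by rewrite nmem_den.
have hc : nmem (den (chk vflag trans_fml) s') vc2 = nmem s' vc2 by rewrite nmem_den.
have ha : nmem (den (chk vflag trans_fml) s') amark = nmem s' amark by rewrite nmem_den.
rewrite den_seq.
move: (den (chk _ _) _) hS hm hc ha => s2 hS hm hc ha hf.
rewrite /Inv /incr /= /upd /= hc hi hm hS ha hf; split=> [y|x xm].
  rewrite ltnS leq_eqVlt eqn_add2l.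
  by case: eqP => [->|_] //=; exact: hI.
by case: eqP => [e|_]; [move: xm; rewrite e; lia|exact: hlt].
Qed.

Lemma layersP s : ready s ->
  (forall y, y < S -> nmem s amark y = init_code B T rho y) ->
  let s' := den layers s in nmem s' vm 0 = n * S /\
  forall y, y < S -> nmem s' amark (n * S + y) = reach (nmem s aord) n y.
Proof.
move=> rs hinit; set s1 := den (vm <~ #0) s.
pose Inv i s' := nmem s' vm 0 = i * S /\
  forall y, y < S -> nmem s' amark (i * S + y) = reach (nmem s aord) i y.
have rs1 : ready s1 by apply: ready_den.
rewrite /layers den_seq -/s1.
suff : Inv (nmem s1 vn 0) (den (CFor vi vn (vv <~ aord:[$vi] ;; next_layer ;; vm <~ $vm +: $vS)) s1).
  by rewrite (ready_n rs1).
apply: for_ind => //.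
move=> i s' _ hi fr hrm [hm hI].
set s2 := den (vv <~ aord:[$vi]) s'.
have rs2 : ready s2.
  by apply: ready_den => //; apply: ready_frame fr hrm _ _ rs1.
have hv : nmem s2 vv 0 = nmem s aord i.
  by rewrite /s2 /= /upd /= hi fr.
have hm2 : nmem s2 vm 0 = i * S by [].
have hn := next_layerP rs2 hm2.
have hm3 : nmem (den next_layer s2) vm 0 = i * S by rewrite nmem_den.
have hS3 : nmem (den next_layer s2) vS 0 = S by rewrite nmem_den // (ready_S rs2).
rewrite !den_seq -/s2.
have ha : nmem s2 amark = nmem s' amark by [].
move: (den next_layer s2) hn hm3 hS3 => s3 hn hm3 hS3.
rewrite /Inv /incr /= /upd /= hm3 hS3 mulSn addnC; split=> // y yS.
rewrite [S + _]addnC hn // hv ha; congr nat_of_bool; apply: eq_in_has => x.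
rewrite mem_iota add0n => /andP[_ xS]; rewrite hI //.
by case: (reach _ _ _).
Qed.

Lemma final_checkP s (ordn : nat -> nat) : ready s -> nmem s vm 0 = n * S ->
  (forall y, y < S -> nmem s amark (n * S + y) = reach ordn n y) ->
  nmem (den final_check s) vans 0 = if accepted ordn then 1 else nmem s vans 0.
Proof.
move=> rs hm hr; have hf := den_chk s wff_final; rewrite fev_final in hf.
have {hf} : nmem (den (chk vflag final_fml) s) vflag 0 = accepted ordn.
  rewrite hf hm (ready_S rs) (ready_B rs) (ready_T rs) (ready_rho rs) (ready_k rs).
  congr nat_of_bool; apply: eq_in_has => x; rewrite mem_iota add0n => /andP[_ xS].
  by rewrite hr //; case: reach.
have ha : nmem (den (chk vflag final_fml) s) vans 0 = nmem s vans 0 by rewrite nmem_den.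
rewrite /final_check den_seq.
move: (den (chk _ _) _) ha => s1 ha hf; rewrite /= hf.
by case: accepted => /=.
Qed.

Lemma scan_shiftP s r : ready s ->
  rmem s 4 0 = (- (c rho).1 + (2 * n + 2 * r)%:R)%R ->
  rmem s 5 0 = ((5 * n)%:R)%R -> rmem s 3 0 = ((2 * w)%:R)%R ->
  exists ordn : nat -> nat, (forall v : 'I_n, ordn (rank (key c rho w S r) v) = v) /\
    let s' := den scan_shift s in
    [/\ nmem s' vans 0 = if accepted ordn then 1 else nmem s vans 0,
      rmem s' 4 0 = (- (c rho).1 + (2 * n + 2 * r.+1)%:R)%R & ready s'].
Proof.
move=> rs h4 h5 h3.
set s1 := den keys s; set s2 := den ranks s1; set s3 := den init_layer s2.
set s4 := den layers s3; set s5 := den final_check s4.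
have r1 : ready s1 by apply: ready_den.
have r2 : ready s2 by apply: ready_den.
have r3 : ready s3 by apply: ready_den.
have r4 : ready s4 by apply: ready_den.
have r5 : ready s5 by apply: ready_den.
have hk := keysP (ready_coords rs) (ready_n rs) (ready_S rs) h4 h5 h3.
have ho := ranksP (ready_n r1) hk.
have hi := init_layerP r2.
have [hm hr] := layersP r3 hi.
have ha := final_checkP r4 hm hr.
have eo : nmem s3 aord = nmem s2 aord by rewrite /s3 nmem_den.
rewrite eo in ha.
exists (nmem s2 aord); split=> //; rewrite /scan_shift 5!den_seq -/s1 -/s2 -/s3 -/s4 -/s5.
split.
- rewrite nmem_den // ha; congr (if _ then _ else _).
  by rewrite /s4 nmem_den // /s3 nmem_den // /s2 nmem_den // /s1 nmem_den.
- have e4 : rmem s5 4 = rmem s 4.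
    by rewrite /s5 rmem_den // /s4 rmem_den // /s3 rmem_den // /s2 rmem_den // /s1 rmem_den.
  move: s5 e4 {ha r5} => s5 e4.
  by rewrite /= /upd /= e4 h4 mulnS addnCA natrD; ring.
- exact: ready_den.
Qed.
End Reach.

Lemma eqb2E a b : eqb2 a b = (a == b).
Proof. by rewrite /eqb2 eqn_leq. Qed.

Lemma code_exists L (g : nat -> nat) : 0 < n -> (forall j, j < L -> g j < n) ->
  exists2 x, x < n ^ L & forall j, j < L -> x %/ n ^ j %% n = g j.
Proof.
move=> n0; elim: L g => [|L IHL] g hg; first by exists 0.
have [|x xL hx] := IHL (fun j => g j.+1); first by move=> j jL; exact: hg.
have g0 : g 0 < n by exact: hg.
exists (x * n + g 0); first by rewrite expnSr; nia.
case=> [_|j jL]; first by rewrite expn0 divn1 modnMDl modn_small.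
by rewrite expnS divnMA divnMDl // [g 0 %/ n]divn_small // addn0 hx.
Qed.

(** * Codes as states of the scan *)

Section Codes.
Variables (B k : nat) (T : nat -> nat -> nat) (isR : nat -> nat) (nr : nat -> nat -> bool).
Variables (R : {set 'I_n}) (r : nat) (ordn : nat -> nat).
Let L := B + B + B + B + 1.
Hypotheses (S_def : S = n ^ L) (B_def : B = 526 * w).
Hypothesis T_digit : forall x j, x < S -> j < L -> T x j = x %/ n ^ j %% n.
Hypothesis isR_def : forall v : 'I_n, isR v = (v \in R).
Hypothesis nr_def : forall u v : 'I_n, nr u v = near c u v.
Hypothesis ordn_def : forall v : 'I_n, ordn (rank (key c rho w S r) v) = v.

Let n_gt0 : 0 < n. Proof. exact: leq_ltn_trans (ltn_ord rho). Qed.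

Let T_lt x j : x < S -> j < L -> T x j < n.
Proof. by move=> xS jL; rewrite T_digit // ltn_mod. Qed.

(** Digits of codes are below [n], so the default [rho] is never taken on them. *)
Let V (a : nat) : 'I_n := insubd rho a.

Let VK a : a < n -> V a = a :> nat.
Proof. by move=> an; rewrite val_insubd an. Qed.

Definition fact_list x b1 b2 : seq (fact 'I_n) :=
  [seq (V (T x (b1 + j)), T x (b2 + j)) | j <- iota 0 B].
Definition takens x := fact_list x 0 B.
Definition pendings x := fact_list x (B + B) (B + B + B).
Definition spending x := T x (B + B + B + B).

Lemma has_factE x b1 b2 u d : x < S -> b1 + B < L -> u < n ->
  has_fact B T x b1 b2 u d = ((V u, d) \in fact_list x b1 b2).
Proof.
move=> xS bL un; rewrite -has_pred1 /fact_list has_map; apply: eq_in_has => j.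
rewrite mem_iota add0n => /andP[_ jB] /=; rewrite !eqb2E xpair_eqE.
by rewrite -(inj_eq val_inj) /= !VK // T_lt // (leq_ltn_trans _ bL) // leq_add2l ltnW.
Qed.

Lemma all_fact (p : nat -> nat -> bool) (q : fact 'I_n -> Prop) x b1 b2 :
    x < S -> b1 + B < L ->
    (forall (u : 'I_n) d, p u d <-> q (u, d)) ->
  all (fun j => p (T x (b1 + j)) (T x (b2 + j))) (iota 0 B) <->
  (forall f, f \in fact_list x b1 b2 -> q f).
Proof.
move=> xS bL hp; have hV j : j < B -> V (T x (b1 + j)) = T x (b1 + j) :> nat.
  by move=> jB; rewrite VK // T_lt // (leq_ltn_trans _ bL) // leq_add2l ltnW.
split=> [/allP h f /mapP[j jB ->]|h].
  apply/hp; move: (jB); rewrite mem_iota add0n => /andP[_ /hV ->]; exact: h.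
apply/allP => j jB; move: (jB); rewrite mem_iota add0n => /andP[_ /hV <-].
by apply/hp/h; apply/mapP; exists j.
Qed.

Lemma skip_codeP (v : 'I_n) x y : x < S -> y < S ->
  skip_code B T isR v x y <->
  skips R v (fun f => f \in takens x) (fun f => f \in pendings x) (spending x)
    (fun f => f \in takens y) (fun f => f \in pendings y) (spending y).
Proof.
move=> xS yS; rewrite /skip_code eqb2E isR_def leqn0 eqb0.
have e1 : all (fun j => has_fact B T x 0 B (T y (0 + j)) (T y (B + j))) (iota 0 B) <->
    (forall f, f \in takens y -> f \in takens x).
  apply: (all_fact (p := has_fact B T x 0 B)) => //; first by rewrite /L; lia.
  by move=> u d; rewrite has_factE // ?/L; [rewrite /V valKd|lia].
have e2 : all (fun j => has_fact B T y (B + B) (B + B + B) (T x (B + B + j)) (T x (B + B + B + j)))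
    (iota 0 B) <-> (forall f, f \in pendings x -> f \in pendings y).
  apply: (all_fact (p := has_fact B T y (B + B) (B + B + B))) => //; first by rewrite /L; lia.
  by move=> u d; rewrite has_factE // ?/L; [rewrite /V valKd|lia].
split=> [/and4P[vR /eqP em /e1 h1 /e2 h2]|[vR /e1 h1 /e2 h2 em]]; first by split.
by apply/and4P; split=> //; apply/eqP.
Qed.

Lemma take_codeP (v : 'I_n) x y : x < S -> y < S ->
  take_code B T isR nr v x y <->
  exists2 d, d < n & takes (near c) R v d (fun f => f \in takens x) (fun f => f \in pendings x)
    (spending x) (fun f => f \in takens y) (fun f => f \in pendings y) (spending y).
Proof.
move=> xS yS; rewrite /take_code eqb2E isR_def.
have B1 : 0 + B < L by rewrite /L; lia.
have B2 : B + B + B < L by rewrite /L; lia.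
have em : (spending y + (v \in R) == spending x + 1) <-> spending y = spending x + (v \notin R).
  by case: (v \in R) => /=; split=> [/eqP|h]; try apply/eqP; lia.
have e1 d : all (fun j => has_fact B T x 0 B (T y (0 + j)) (T y (B + j)) ||
      eqb2 (T y (0 + j)) v && eqb2 (T y (B + j)) d) (iota 0 B) <->
    (forall f, f \in takens y -> f \in takens x \/ f = (v, d)).
  apply: (all_fact (p := fun a b => has_fact B T x 0 B a b || eqb2 a v && eqb2 b d)) => //.
  move=> u e; rewrite has_factE // /V valKd !eqb2E; split.
    by case/orP=> [|/andP[/eqP /val_inj -> /eqP ->]]; [left|right].
  by case=> [->//|[-> ->]]; rewrite !eqxx orbT.
have e2 d : all (fun j => has_fact B T y (B + B) (B + B + B) (T x (B + B + j)) (T x (B + B + B + j)) ||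
      eqb2 (T x (B + B + B + j)) (d + 1) && nr v (T x (B + B + j))) (iota 0 B) <->
    (forall f, f \in pendings x -> f \in pendings y \/ f.2 = d.+1 /\ near c v f.1).
  apply: (all_fact (p := fun a b => has_fact B T y (B + B) (B + B + B) a b ||
    eqb2 b (d + 1) && nr v a)) => //.
  move=> u e; rewrite has_factE // /V valKd !eqb2E nr_def addn1 /=; split.
    by case/orP=> [|/andP[/eqP -> ->]]; [left|right].
  by case=> [->//|[-> ->]]; rewrite !eqxx orbT.
have e3 d : has_fact B T y (B + B) (B + B + B) v d ||
      has (fun j => eqb2 (T x (B + j) + 1) d && nr (T x (0 + j)) v) (iota 0 B) <->
    (v, d) \in pendings y \/ exists2 f, f \in takens x & f.2.+1 = d /\ near c f.1 v.
  rewrite has_factE // /V valKd.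
  have hV j : j < B -> V (T x (0 + j)) = T x (0 + j) :> nat.
    by move=> jB; rewrite VK // T_lt // /L; lia.
  split.
    case/orP=> [|/hasP[j]]; [by left|rewrite mem_iota add0n => /andP[_ jB]].
    rewrite eqb2E addn1 -hV // nr_def => /andP[/eqP ed vn].
    right; exists (V (T x (0 + j)), T x (B + j)) => //.
    by apply/mapP; exists j; rewrite // mem_iota.
  case=> [->//|[f /mapP[j]]]; rewrite mem_iota => /andP[_ jB] -> [/= ed fv].
  apply/orP; right; apply/hasP; exists j; first by rewrite mem_iota.
  by rewrite eqb2E addn1 ed eqxx -hV // nr_def.
split=> [/andP[/em h0 /hasP[d dn /and3P[/e1 h1 /e2 h2 /e3 h3]]]|[d dn [/e1 h1 /e2 h2 /e3 h3 /em h0]]].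
  by exists d => //; move: dn; rewrite mem_iota.
by apply/andP; split=> //; apply/hasP; exists d; rewrite ?mem_iota //; apply/and3P.
Qed.

Lemma step_codeP (v : 'I_n) x y : x < S -> y < S ->
  skip_code B T isR v x y || take_code B T isR nr v x y <->
  scan_step (near c) R n v (fun f => f \in takens x) (fun f => f \in pendings x) (spending x)
    (fun f => f \in takens y) (fun f => f \in pendings y) (spending y).
Proof.
move=> xS yS; rewrite /scan_step -skip_codeP // -take_codeP //.
by split=> [/orP|h]; last exact/orP.
Qed.

Let root_facts x b1 b2 : x < S -> b1 + B < L ->
  all (fun j => eqb2 (T x (b1 + j)) rho && eqb2 (T x (b2 + j)) 0) (iota 0 B) <->
  (forall f, f \in fact_list x b1 b2 -> f = (rho, 0)).
Proof.
move=> xS bL; apply: (all_fact (p := fun a b => eqb2 a rho && eqb2 b 0)) => // u d.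
rewrite !eqb2E; split=> [/andP[/eqP /val_inj -> /eqP ->]//|[-> ->]].
by rewrite !eqxx.
Qed.

Lemma init_codeP x : x < S -> init_code B T rho x <->
  (forall f, f \in takens x ++ pendings x -> f = (rho, 0)) /\ spending x = 0.
Proof.
move=> xS; rewrite /init_code eqb2E.
have e1 := @root_facts x 0 B xS; have e2 := @root_facts x (B + B) (B + B + B) xS.
split=> [/and3P[/e1 h1 /e2 h2 /eqP h3]|[h h3]].
  by split=> // f; rewrite mem_cat => /orP[/h1|/h2]; apply; rewrite /L; lia.
apply/and3P; split; last exact/eqP.
- by apply/e1 => [|f hf]; [rewrite /L; lia|apply: h; rewrite mem_cat hf].
- by apply/e2 => [|f hf]; [rewrite /L; lia|apply: h; rewrite mem_cat hf orbT].
Qed.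

Lemma final_codeP x : x < S -> final_code B T rho k x <->
  (forall f, f \in pendings x -> f = (rho, 0)) /\ spending x <= k.
Proof.
move=> xS; rewrite /final_code.
have e2 : _ <-> _ := @root_facts x (B + B) (B + B + B) xS _.
by split=> [/andP[/e2 h2 h3]|[/e2 h h3]]; [split=> //; apply: h2|apply/andP; split=> //];
  rewrite /L; lia.
Qed.

Let ordnE i : i < n -> ordn i = order c rho w S r i.
Proof. by move=> iN; rewrite -ordn_def /order unrankK. Qed.

Lemma encode_state (P Q : seq (fact 'I_n)) m : size P = B -> size Q = B -> m < n ->
  (forall f, f \in P ++ Q -> f.2 < n) ->
  exists2 x, x < S & [/\ takens x = P, pendings x = Q & spending x = m].
Proof.
(* The four lists have [4 * B] entries in all, so the default value [m] of [nth] supplies the last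
   digit, the count. *)
move=> sP sQ mn lt; pose g j :=
  nth m (map (val \o fst) P ++ map snd P ++ map (val \o fst) Q ++ map snd Q) j.
have [|x xS hx] := @code_exists L g n_gt0.
  move=> j _; rewrite /g; set s := _ ++ _.
  have [js|js] := ltnP j (size s); last by rewrite nth_default.
  have := mem_nth m js; rewrite /s !mem_cat => /or4P[] /mapP[f fP ->] /=; rewrite ?ltn_ord //;
    by apply: lt; rewrite mem_cat fP ?orbT.
rewrite -S_def in xS; exists x => //.
have hT j : j < L -> T x j = g j by move=> jL; rewrite T_digit // hx.
have fl b1 b2 (F : seq (fact 'I_n)) : size F = B -> b1 + B < L -> b2 + B < L ->
    (forall j, j < B -> g (b1 + j) = (nth (rho, 0) F j).1) ->
    (forall j, j < B -> g (b2 + j) = (nth (rho, 0) F j).2) -> fact_list x b1 b2 = F.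
  move=> sF b1L b2L h1 h2; apply: (@eq_from_nth _ (rho, 0)); rewrite size_map size_iota // => j jB.
  rewrite (nth_map 0) ?size_iota // nth_iota // add0n !hT; [|lia|lia].
  by rewrite h1 // h2 // /V valKd; case: nth.
have nl (F : seq (fact 'I_n)) j : size F = B -> j < B ->
    nth m (map (val \o fst) F) j = (nth (rho, 0) F j).1 :> nat /\
    nth m (map snd F) j = (nth (rho, 0) F j).2.
  by move=> sF jB; rewrite !(nth_map (rho, 0)) ?sF.
split.
- apply: fl => //; rewrite ?/L; try lia; move=> j jB; have [n1 n2] := nl P j sP jB.
    by rewrite /g nth_cat size_map sP jB n1.
  by rewrite /g !nth_cat !size_map sP; have -> : (B + j < B) = false by [lia];
    rewrite addKn jB.
- apply: fl => //; rewrite ?/L; try lia; move=> j jB; have [n1 n2] := nl Q j sQ jB.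
    rewrite /g !nth_cat !size_map sP sQ; have -> : (B + B + j < B) = false by lia.
    have -> : (B + B + j - B < B) = false by lia.
    by have -> : B + B + j - B - B = j by [lia]; rewrite jB.
  rewrite /g !nth_cat !size_map sP sQ; have -> : (B + B + B + j < B) = false by lia.
  have -> : (B + B + B + j - B < B) = false by lia.
  have -> : (B + B + B + j - B - B < B) = false by lia.
  by have -> : B + B + B + j - B - B - B = j by lia.
- rewrite /spending hT ?/L; last lia.
  by rewrite /g nth_default // !size_cat !size_map sP sQ; lia.
Qed.

(** Every code decodes to lists of [B] facts with distances below [n], so a chain of marked codes is
    a run. Conversely, [encode_state] gives a code for each state of a run. *)
Lemma acceptedP : accepted B k T isR nr ordn <->
  exists P Q m, scan_run c R rho k w S r P Q m.
Proof.
split.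
- have chain i y : i <= n -> y < S -> reach B T isR nr ordn i y ->
      exists f : nat -> nat, [/\ f i = y, forall j, j <= i -> f j < S,
        init_code B T rho (f 0) & forall j, j < i ->
        skip_code B T isR (ordn j) (f j) (f j.+1) || take_code B T isR nr (ordn j) (f j) (f j.+1)].
    elim: i y => [|i IHi] y iN yS /=; first by move=> iy; exists (fun _ => y).
    case/hasP=> x; rewrite mem_iota add0n => /andP[_ xS] /andP[rx xy].
    have [f [fi fS f0 fs]] := IHi x (ltnW iN) xS rx.
    exists (fun j => if j == i.+1 then y else f j); split=> //; first by rewrite eqxx.
      by move=> j ji; case: eqP => // /eqP jn; apply: fS; lia.
    move=> j; rewrite ltnS leq_eqVlt => /orP[/eqP->|ji].
      by rewrite eqxx (ltn_eqF (ltnSn i)) fi.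
    by rewrite (ltn_eqF (ltnW _)) // eqSS (ltn_eqF ji) fs.
  case/hasP=> y; rewrite mem_iota add0n => /andP[_ yS] /andP[ry fy].
  have [f [fn fS f0 fs]] := chain n y (leqnn n) yS ry.
  exists (fun i => takens (f i)), (fun i => pendings (f i)), (fun i => spending (f i)).
  have [hs hz] : _ /\ _ := (init_codeP (fS 0 (leq0n n))).1 f0.
  have [he hk] := (final_codeP yS).1 fy.
  have flt x b1 b2 g : x < S -> b2 + B < L -> g \in fact_list x b1 b2 -> g.2 < n.
    move=> xS bL /mapP[j]; rewrite mem_iota => /andP[_ jB] -> /=.
    by apply: T_lt => //; lia.
  split=> //.
  + by move=> i _; rewrite !size_map size_iota.
  + move=> i g /fS iS; rewrite mem_cat => /orP[]; apply: flt => //; rewrite /L; lia.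
  + by move=> i /fS iS; apply: T_lt => //; rewrite /L; lia.
  + by move=> g; rewrite fn; exact: he.
  + by rewrite fn.
  + move=> i iN; apply/step_codeP; rewrite ?fS // ?(ltnW iN) //.
    by rewrite -ordnE // fs.
case=> P [Q [m [sz lt slt st s0 en sk steps]]].
have enc i : i <= n -> exists2 x, x < S &
    [/\ takens x = P i, pendings x = Q i & spending x = m i].
  move=> iN; have [sP sQ] := sz i iN; apply: encode_state; rewrite ?B_def //.
    exact: slt.
  by move=> f; apply: lt.
have rch i x : i <= n -> x < S -> takens x = P i -> pendings x = Q i -> spending x = m i ->
    reach B T isR nr ordn i x.
  elim: i x => [|i IHi] x iN xS eP eQ em /=.
    by apply/init_codeP => //; rewrite eP eQ em.
  have [y yS [fP fQ fm]] := enc i (ltnW iN).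
  apply/hasP; exists y; first by rewrite mem_iota.
  rewrite (IHi y) ?(ltnW iN) //= ordnE //; apply/step_codeP => //.
  by rewrite eP eQ em fP fQ fm; apply: steps.
have [x xS [eP eQ em]] := enc n (leqnn n).
apply/hasP; exists x; first by rewrite mem_iota.
by rewrite rch //=; apply/final_codeP; rewrite // eQ em.
Qed.
End Codes.

Lemma scan_allP s (R : {set 'I_n}) k : 2 <= n -> 0 < w ->
  nmem s vn 0 = n -> nmem s vw 0 = w -> nmem s vB 0 = 526 * w ->
  nmem s vL 0 = 526 * w + 526 * w + 526 * w + 526 * w + 1 ->
  nmem s vS 0 = S -> S = n ^ nmem s vL 0 ->
  nmem s vrho 0 = rho -> nmem s 0 2 = k ->
  (forall v : 'I_n, nmem s aR v = (v \in R)) -> coords s ->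
  nmem s vq 0 = 0 -> nmem s vrem 0 = 0 -> nmem s vo 0 = 0 -> nmem s vans 0 = 0 ->
  rmem s 3 0 = 0%R -> rmem s 5 0 = 0%R ->
  nmem (den scan_all s) 0 0 = 1 <-> exists2 r, r < w & exists P Q m, scan_run c R rho k w S r P Q m.
Proof.
move=> n2 w0 hn hw hB hL hS eS hrho hk hR hc hq hrem ho hans h3 h5.
have n0 : 0 < n by exact: ltnW.
set s1 := den quotients s; set s2 := den digits s1; set s3 := den reals s2.
have e1 a : a \notin nmods quotients -> nmem s1 a = nmem s a by exact: nmem_den.
have e2 a : a \notin nmods digits -> nmem s2 a = nmem s1 a by exact: nmem_den.
have e3 a : a \notin nmods reals -> nmem s3 a = nmem s2 a by exact: nmem_den.
have er1 a : rmem s1 a = rmem s a by rewrite rmem_den.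
have er2 a : rmem s2 a = rmem s a by rewrite rmem_den // er1.
have er3 a : a \notin rmods reals -> rmem s3 a = rmem s a by move=> ha; rewrite rmem_den // er2.
have hquo := quotientsP n0 hn hq hrem.
have ho1 : nmem s1 vo 0 = 0 by rewrite e1.
have hS1 : nmem s1 vS 0 = S by rewrite e1.
have hL1 : nmem s1 vL 0 = nmem s vL 0 by rewrite e1.
rewrite hS -hS1 in hquo.
have hdig := digitsP n0 ho1 hquo; rewrite hS1 hL1 hL -/s2 in hdig.
have [|||||h4 h5' h3'] := @realsP s2 n w rho.
- by rewrite e2 // e1.
- by rewrite e2 // e1.
- by rewrite e2 // e1.
- by rewrite er2.
- by rewrite er2.
set T := table s3; set isR := nmem s3 aR; set nr := near_at s3.
have cs3 : coords s3 by case: hc => hx hy; split=> v; rewrite er3.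
have rs3 : ready (526 * w) k T isR nr s3.
  by split=> //; rewrite e3 // e2 // e1.
have T_digit x j : x < S -> j < 526 * w + 526 * w + 526 * w + 526 * w + 1 -> T x j = x %/ n ^ j %% n.
  by move=> xS jL; rewrite /T /table !e3 //; exact: hdig.
have isR_def (v : 'I_n) : isR v = (v \in R) by rewrite /isR e3 // e2 // e1.
have nr_def (u v : 'I_n) : nr u v = near c u v.
  by case: cs3 => hx hy; rewrite /nr /near_at !hx !hy /near !GRing.expr2.
rewrite hL in eS.
have accP r ordn := @acceptedP _ k T isR nr R r ordn eS erefl T_digit isR_def nr_def.
have -> : den scan_all s = den (0 <~ $vans) (den (CFor vr vw scan_shift) s3).
  by rewrite /scan_all 4!den_seq.
pose Inv i s' := [/\ ready (526 * w) k T isR nr s',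
  rmem s' 4 0 = (- (c rho).1 + (2 * n + 2 * i)%:R)%R &
  nmem s' vans 0 = 1 <-> exists2 r, r < i & exists P Q m, scan_run c R rho k w S r P Q m].
have hw3 : nmem s3 vw 0 = w by rewrite e3 // e2 // e1.
suff [_ _ h] : Inv (nmem s3 vw 0) (den (CFor vr vw scan_shift) s3).
  by rewrite hw3 in h; rewrite -h.
apply: for_ind => //.
  split.
  - exact: ready_setn.
  - by rewrite [LHS]/= h4 muln0 addn0 er2 (coord_x hc).
  - have -> : nmem (setn s3 vr 0 0) vans 0 = nmem s3 vans 0 by [].
    rewrite e3 // e2 // e1 // hans.
    by split=> // -[r].
move=> i s' ib hi fr hrm [rs' h4i hI].
have [||ordn [ho' [ha h4' rs'']]] := scan_shiftP rs' h4i.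
- by rewrite hrm.
- by rewrite hrm.
rewrite /Inv /incr; move: (den scan_shift s') ha h4' rs'' => s4 ha h4' rs''.
split.
- exact: ready_setn.
- exact: h4'.
- have -> : nmem (setn s4 vr 0 (nmem s4 vr 0 + 1)) vans 0 = nmem s4 vans 0 by [].
  rewrite ha; have [acc|acc] := boolP (accepted _ _ _ _ _ _).
    by split=> // _; exists i => //; apply/accP; first exact: ho'.
  rewrite hI; split=> [[r ri hr]|[r]]; first by exists r => //; exact: ltnW.
  rewrite ltnS leq_eqVlt => /orP[/eqP-> /(accP i ordn ho')|ri hr]; last by exists r.
  by move=> h; rewrite h in acc.
Qed.
End Layers.

(** * Parameters and the complete execution *)

Lemma find_rootP s n (R : {set 'I_n}) : nmem s vn 0 = n ->
  (forall v : 'I_n, nmem s aR v = (v \in R)) -> nmem s vfound 0 = 0 ->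
  let s' := den find_root s in
  (nmem s' vfound 0 = 0 /\ R = finset.set0) \/
  nmem s' vfound 0 = 1 /\ exists2 rho, rho \in R & nmem s' vrho 0 = rho.
Proof.
move=> hn hR h0 s'.
pose Inv i s' := (nmem s' vfound 0 = 0 /\ forall v : 'I_n, v < i -> v \notin R) \/
  nmem s' vfound 0 = 1 /\ exists2 rho, rho \in R & nmem s' vrho 0 = rho.
suff : Inv (nmem s vn 0) s'.
  case=> [[h hno]|h]; [left|by right]; split=> //; apply/setP => v.
  by rewrite finset.inE; apply/negbTE/hno; rewrite hn.
apply: for_ind => //; first by left.
move=> i s2 ib hi fr _ hI; rewrite hn in ib; pose v := Ordinal ib.
have hv : nmem s2 aR i = (v \in R) by rewrite fr //; exact: hR v.
rewrite /Inv /incr /= hi hv; have [vR|vR] /= := boolP (v \in R); rewrite /upd /= ?hi.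
  by right; split=> //; exists v.
case: hI => [[h hno]|h]; [left|by right]; split=> // u.
rewrite ltnS leq_eqVlt => /orP[/eqP ui|]; last exact: hno.
by have -> : u = v by apply: val_inj; exact: ui.
Qed.

Lemma find_widthP s N : nmem s vN 0 = N -> 0 < N -> nmem s vw 0 = 0 -> nmem s vsq 0 = 0 ->
  exists w, [/\ nmem (den find_width s) vw 0 = w.+1, N <= w.+1 * w.+1 & w * w < N].
Proof.
move=> hN N0 w0 sq0.
(* Either the square has reached [N] or the width has grown in every round; after [N] rounds the
   latter gives [N <= N * N]. The last clause keeps the width minimal, as the time bound
   requires. *)
pose Inv i s' := exists w, [/\ nmem s' vw 0 = w, nmem s' vsq 0 = w * w,
  N <= w * w \/ w = i & w = 0 \/ w.-1 * w.-1 < N].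
suff [w [hw _ h1 h2]] : Inv (nmem s vN 0) (den find_width s).
  rewrite hN in h1; case: w hw h1 h2 => [|w] hw h1 h2; first by case: h1; lia.
  exists w; split=> //; last by case: h2.
  by case: h1 => // ->; rewrite leq_pmulr.
apply: for_ind => //; first by exists 0; split; auto.
move=> i s' _ hi fr _ [w [hw hsq h1 h2]].
have hN' : nmem s' vN 0 = N by rewrite fr.
rewrite /Inv /incr /= hN' hsq; case: leqP => h /=; rewrite /upd /= ?hw ?hsq.
  by exists w; split=> //; left.
exists (w + 1); split; [by []|by lia| |by right; rewrite addn1].
by right; case: h1 => [h'|->]; [move: h; rewrite ltnNge h'|rewrite addn1].
Qed.

Lemma find_slotsP s slots w : nmem s vw 0 = w -> nmem s vB 0 = 0 ->
  let s' := den (find_slots slots) s in let B := slots * w in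
  [/\ nmem s' vB 0 = B, nmem s' vL 0 = B + B + B + B + 1 & nmem s' vS 0 = 1].
Proof.
move=> hw hB; rewrite /find_slots 2!den_seq.
have h : nmem (den (CFor vl vw (vB <~ $vB +: #slots)) s) vB 0 = slots * w.
  pose Inv i s' := nmem s' vB 0 = slots * i.
  suff : Inv (nmem s vw 0) (den (CFor vl vw (vB <~ $vB +: #slots)) s) by rewrite hw.
  apply: for_ind => //; first by rewrite /Inv /= /upd /= hB muln0.
  by move=> i s' _ _ _ _ hI; rewrite /Inv /incr /= /upd /= hI mulnS addnC.
by move: (den _ s) h => s1 h; rewrite /= /upd /= h.
Qed.

Lemma find_codesP s n : nmem s vn 0 = n -> nmem s vS 0 = 1 ->
  nmem (den find_codes s) vS 0 = n ^ nmem s vL 0.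
Proof.
move=> hn hS; pose Inv i s' := nmem s' vS 0 = n ^ i.
suff : Inv (nmem s vL 0) (den find_codes s) by [].
apply: for_ind => //.
move=> i s' _ _ fr _ hI; rewrite 2!den_seq /Inv; set s1 := den (vacc <~ #0) s'.
have hn1 : nmem s1 vn 0 = n by rewrite nmem_den // fr.
have : nmem (den mul_S s1) vacc 0 = n ^ i * n.
  pose Inv' j s' := nmem s' vacc 0 = n ^ i * j /\ nmem s' vS 0 = n ^ i.
  suff [] : Inv' (nmem s1 vn 0) (den mul_S s1) by rewrite hn1.
  apply: for_ind => //; first by split; rewrite ?muln0.
  by move=> j s2 _ _ _ _ [h1 h2]; rewrite /Inv' /incr /= /upd /= h1 h2 mulnS addnC.
by move: (den mul_S s1) => s2 h; rewrite /incr /= /upd /= h expnSr.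
Qed.

(* Not run as such; its cost bounds that of all parts of the program. *)
Definition phases : cmd :=
  (vn <~ 0:[#0] ;; vN <~ 0:[#1] +: 0:[#2]) ;; find_root ;; (0 <~ #1) ;;
  find_width ;; find_slots 526 ;; find_codes ;; scan_all.

Lemma cost_seq D c1 c2 : cost D (c1 ;; c2) = cost D c1 + cost D c2.
Proof. by []. Qed.


Lemma prog_run n (c : 'I_n -> K * K) (R : {set 'I_n}) (t k : nat) :
    #|R| = t -> 0 < k -> 2 <= n ->
  exists w m s, [/\ w * w < t + k, exec (steiner_prog 526) (input c R t k) m s,
    m <= cost (n ^ (2104 * w.+1 + 1)) phases + 2
    & accepts s <-> steiner_yes (disk_graph c) R k].
Proof.
move=> cR k0 n2; set s0 := input c R t k.
have n0 : 0 < n by exact: ltnW.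
set s1 := den (vn <~ 0:[#0] ;; vN <~ 0:[#1] +: 0:[#2]) s0.
have hn1 : nmem s1 vn 0 = n by [].
have hN1 : nmem s1 vN 0 = t + k by [].
have hR1 (v : 'I_n) : nmem s1 aR v = (v \in R).
  by rewrite /s1 nmem_den //= insubT //= => h; congr nat_of_bool; congr (_ \in R); exact: val_inj.
have hc1 : coords c s1.
  by split=> v; rewrite /= insubT //= => h; congr (c _).1 || congr (c _).2; exact: val_inj.
have hz a : 2 <= a -> a \notin [:: vn; vN] -> forall i, nmem s1 a i = 0.
  by move=> a2 ha i; rewrite /s1 nmem_den //=; case: a a2 {ha} => [|[|a]].
set s2 := den find_root s1.
have e2 a : a \notin nmods find_root -> nmem s2 a = nmem s1 a by exact: nmem_den.
have root := @find_rootP s1 n R hn1 hR1 (hz vfound isT isT 0).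
set s3 := den find_width s2.
have e3 a : a \notin nmods find_width -> nmem s3 a = nmem s2 a by exact: nmem_den.
have [||||w [hw Nw wN]] := @find_widthP s2 (t + k).
- by rewrite e2.
- by rewrite addn_gt0 k0 orbT.
- by rewrite e2 // hz.
- by rewrite e2 // hz.
rewrite -/s3 in hw; exists w.
set S := n ^ (2104 * w.+1 + 1).
have powle a b : a <= b -> n ^ a <= n ^ b by move=> ab; rewrite leq_pexp2l.
have le_S a : a <= 2104 * w.+1 + 1 -> a <= S.
  by move=> h; apply: leq_trans (powle _ _ h); apply: ltnW; exact: ltn_expl.
have nS : n <= S by rewrite -[X in X <= _]expn1; apply: powle; lia.
(* [k] is not bounded in terms of [n], but [t + k] is at most the square of the width, and
   [a < n ^ a] since [n] is at least 2. *)
have NS : t + k <= S.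
  apply: leq_trans Nw _; apply: (@leq_trans (n ^ w.+1 * n ^ w.+1)).
    by apply: leq_mul; apply: ltnW; exact: ltn_expl.
  by rewrite -expnD; apply: powle; lia.
have [m0 [x0 l0]] := @exec_comp K [::] S _ s0 (isT : bounded_by [::] (vn <~ 0:[#0] ;; vN <~ 0:[#1] +: 0:[#2])) (fun b => fun h : b \in [::] => False_ind _ (notF h)).
have [|m1 [x1 l1]] := @exec_comp K [:: vn] S find_root s1 isT.
  by move=> b; rewrite mem_seq1 => /eqP->; rewrite hn1.
have test0 : teval s0 (0:[#0] <=: #1) = false by rewrite /= leqNgt n2.
have cost_parts : cost S phases = cost S (vn <~ 0:[#0] ;; vN <~ 0:[#1] +: 0:[#2]) +
    (cost S find_root + (cost S (0 <~ #1) + (cost S find_width + (cost S (find_slots 526) +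
    (cost S find_codes + cost S scan_all))))) by rewrite /phases 6!cost_seq.
case: root => [[nf R0]|[f1 [rho rhoR hrho]]]; rewrite -/s2 in nf || rewrite -/s2 in f1 hrho.
  exists (m0 + (m1 + 1.+1)).+1, (den (0 <~ #1) s2); split=> //.
  - constructor; rewrite test0; apply: exec_seq x0 _; apply: exec_seq x1 _.
    by constructor; rewrite /= nf /=; constructor.
  - by rewrite cost_parts; have : cost S (0 <~ #1) = 1 by []; lia.
  (* The one vertex of this tree is a Steiner vertex, which [0 < k] allows. *)
  - split=> // _; pose v0 := Ordinal n0; exists [set v0], (fun _ _ => false); split.
    + by split.
    + split; first by apply/set0Pn; exists v0; rewrite finset.inE.
        by move=> u v; rewrite !finset.inE => /eqP-> /eqP->.
      by case=> [|u [|v p]] // /andP[]; rewrite /= => /andP[].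
    + by rewrite R0 finset.sub0set.
    + by rewrite R0 finset.setD0 cards1.
have test1 : teval s2 ($vfound <=: #0) = false by rewrite /= f1.
set s4 := den (find_slots 526) s3.
have e4 a : a \notin nmods (find_slots 526) -> nmem s4 a = nmem s3 a by exact: nmem_den.
have [|hB hL hS1] := @find_slotsP s3 526 w.+1 hw; first by rewrite e3 // e2 // hz.
rewrite -/s4 in hB hL hS1.
set s5 := den find_codes s4.
have e5 a : a \notin nmods find_codes -> nmem s5 a = nmem s4 a by exact: nmem_den.
have hn4 : nmem s4 vn 0 = n by rewrite e4 // e3 // e2.
have hS := find_codesP hn4 hS1; rewrite -/s5 in hS.
have eL : nmem s4 vL 0 = 2104 * w.+1 + 1 by rewrite hL; lia.
rewrite eL -/S in hS.
have [|m3 [x3 l3]] := @exec_comp K [:: vN] S find_width s2 isT.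
  by move=> b; rewrite mem_seq1 => /eqP->; rewrite e2 // hN1.
have [|m4 [x4 l4]] := @exec_comp K [:: vw] S (find_slots 526) s3 isT.
  by move=> b; rewrite mem_seq1 => /eqP->; rewrite hw; apply: le_S; lia.
have [|m5 [x5 l5]] := @exec_comp K [:: vL; vn] S find_codes s4 isT.
  move=> b; rewrite !inE => /orP[] /eqP->; last by rewrite hn4.
  by rewrite eL; exact: le_S.
have hB5 : nmem s5 vB 0 = 526 * w.+1 by rewrite e5.
have hL5 : nmem s5 vL 0 = 2104 * w.+1 + 1 by rewrite e5.
have hw5 : nmem s5 vw 0 = w.+1 by rewrite e5 // e4.
have hn5 : nmem s5 vn 0 = n by rewrite e5.
have [|m6 [x6 l6]] := exec_comp (D := S) bounded_scan (s := s5).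
  move=> b; rewrite !inE => /or4P[/eqP->|/eqP->|/eqP->|/orP[]/eqP->].
  - by rewrite hn5.
  - by rewrite hw5; apply: le_S; lia.
  - by rewrite hB5; apply: le_S; lia.
  - by rewrite hL5; exact: le_S.
  - by rewrite hS.
exists (m0 + (m1 + (m3 + (m4 + (m5 + m6))).+1)).+1, (den scan_all s5); split=> //.
- constructor; rewrite test0; apply: exec_seq x0 _; apply: exec_seq x1 _.
  constructor; rewrite test1; apply: exec_seq x3 _; apply: exec_seq x4 _.
  exact: exec_seq x5 x6.
- rewrite cost_parts; clear -l0 l1 l3 l4 l5 l6; move: l0 l1 l3 l4 l5 l6.
  generalize (cost S find_root) (cost S find_width) (cost S (find_slots 526))
    (cost S find_codes) (cost S scan_all).
  by move=> a1 a3 a4 a5 a6 *; lia.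
have e1r a : rmem s5 a = rmem s0 a.
  by rewrite /s5 rmem_den // /s4 rmem_den // /s3 rmem_den // /s2 rmem_den.
have e15 a : [&& a \notin nmods find_root, a \notin nmods find_width,
    a \notin nmods (find_slots 526) & a \notin nmods find_codes] -> nmem s5 a = nmem s1 a.
  by case/and4P=> h2 h3 h4 h5; rewrite (e5 _ h5) (e4 _ h4) (e3 _ h3) (e2 _ h2).
have SL : 2 * n + 1 <= S.
  apply: (@leq_trans (n ^ 3)); last by apply: powle; lia.
  by rewrite !expnS expn0; nia.
have accP : nmem (den scan_all s5) 0 0 = 1 <-> exists2 r, r < w.+1 & exists P Q m,
    scan_run c R rho k w.+1 S r P Q m.
  apply: scan_allP => //.
  - by rewrite hL5; lia.
  - by rewrite hL5.
  - by rewrite e5 // e4 // e3.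
  - by rewrite e15.
  - by move=> v; rewrite e15.
  - by case: hc1 => hx hy; split=> v; rewrite e1r; [exact: hx|exact: hy].
  - by rewrite e15 // hz.
  - by rewrite e15 // hz.
  - by rewrite e15 // hz.
  - by rewrite e15 // hz.
  - by rewrite e1r /=; case: insub.
  - by rewrite e1r /=; case: insub.
rewrite /accepts; split=> [/eqP /accP[r rw [P [Q [m run]]]]|yes].
  exact: scan_run_sound run.
by apply/eqP/accP; apply: scan_run_complete => //; rewrite cR.
Qed.
End Program.

Lemma steiner_yes_small (K : realType) n (c : 'I_n -> K * K) (R : {set 'I_n}) k :
  (n <= 1)%N -> (0 < k)%N -> steiner_yes (disk_graph c) R k <-> n = 1%N.
Proof.
case: n c R => [|[|//]] c R _ k0; split=> //.
  by case=> X [eT [_ [/set0Pn[[]]]]].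
move=> _; exists finset.setT, (fun _ _ => false); split.
- by split.
- split; first by apply/set0Pn; exists ord0; rewrite finset.inE.
    by move=> u v _ _; rewrite (ord1 u) (ord1 v).
  by case=> [|u [|v p]] // /andP[] /= /andP[].
- exact: finset.subsetT.
- by apply: leq_trans k0; rewrite -[leqRHS](card_ord 1); exact: max_card.
Qed.

Theorem theorem1 (K : realType) :
  exists (P : prog) (C : nat),
    forall (n : nat) (c : 'I_n -> K * K) (R : {set 'I_n}) (t k : nat),
      #|R| = t -> (0 < k)%N ->
      exists (m : nat) (s : state K),
        [/\ exec P (input c R t k) m s,
            m%:R <= C%:R * (1 + n%:R `^ (C%:R * Num.sqrt (t + k)%:R)) :> K
          & accepts s <-> steiner_yes (disk_graph c) R k].
Proof.
have [q hq] := cost_poly phases.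
(* Four numbers for each of the [526 * w.+1] pairs of slots give 2104. As [w] and 1 are at most the
   square root [r] of [t + k], the exponent [2104 * w.+1 + 2] is at most [(2104 + 2106) * r]. The
   added 2 absorbs the two outer tests of the program. *)
exists (steiner_prog 526), (4210 * q + 2)%N => n c R t k cR k0.
set C : K := (4210 * q + 2)%:R.
have C2 : 2 <= C by rewrite ler_nat leq_addl.
have [n1|n2] := leqP n 1.
  exists 1%N, (input c R t k); split.
  - by constructor; rewrite /= n1; constructor.
  - have p0 : 0 <= n%:R `^ (C * Num.sqrt (t + k)%:R) :> K by exact: powR_ge0.
    apply: (@le_trans _ _ (1 * 1)); first by rewrite mulr1.
    by apply: ler_pM => //; lra.
  - by rewrite steiner_yes_small // /accepts /=; split=> [/eqP|->].
have [w [m [s [wN run hm acc]]]] := prog_run c cR k0 n2.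
exists m, s; split=> //.
(* [cost_poly] bounds the time by a power of [S + 1]; for [n] at least 2, one more factor [n] covers
   the 1 added to [S]. *)
set e := ((2104 * w.+1 + 2) * q)%N.
have {hm} hm : (m <= q * n ^ e + 2)%N.
  apply: leq_trans hm _; rewrite leq_add2r; apply: leq_trans (hq _) _.
  rewrite leq_mul2l expnM; case: posnP => //= q0; rewrite leq_exp2r //.
  by rewrite ltn_exp2l // ltn_add2l.
set r : K := Num.sqrt (t + k)%:R.
have r1 : 1 <= r.
  by rewrite -sqrtr1 ler_wsqrtr // ler1n addn_gt0 k0 orbT.
have wr : w%:R <= r.
  rewrite -[leLHS]ger0_norm // -sqrtr_sqr ler_wsqrtr // -natrX ler_nat.
  by rewrite -mulnn ltnW.
have er : e%:R <= C * r.
  have q0 : 0 <= q%:R :> K by [].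
  have -> : C = 4210 * q%:R + 2 by rewrite /C natrD natrM.
  rewrite /e natrM [leLHS]mulrC mulrDl.
  have : (2104 * w.+1 + 2)%:R <= 4210 * r.
    by rewrite natrD natrM mulrSr; lra.
  move=> /(ler_wpM2l q0) h; apply: le_trans h _.
  by rewrite mulrCA mulrA lerDl mulr_ge0 //; lra.
have nr1 : 1 <= n%:R :> K by rewrite ler1n ltnW.
have pe : (n ^ e)%:R <= n%:R `^ (C * r).
  by rewrite natrX -powR_mulrn ?ler0n // ler_powR.
apply: le_trans (_ : (q * n ^ e + 2)%:R <= _); first by rewrite ler_nat.
rewrite natrD natrM; move: pe; set x := _ `^ _; set y := (n ^ e)%:R => pe.
have y0 : 0 <= y by exact: ler0n.
have q0 : 0 <= q%:R :> K by exact: ler0n.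
have qC : q%:R + 2 <= C by rewrite /C natrD natrM lerD2r ler_peMl //; lra.
apply: le_trans (_ : (q%:R + 2) * (1 + y) <= _); first by nra.
by apply: ler_pM; rewrite ?lerD2l //; lra.
Qed.
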